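(* Let $\varepsilon=1$ and $F=-\nabla_xU$. Assume that the numerical solution of the filtered two-step variational integrator FVI with stepsize $h$ belongs to a compact set that is independent of $h$. Let $N\ge3$ be an integer (the truncation number). Then the energy $H(x,v)=\tfrac12|v|^2+U(x)$ is nearly preserved along the integrator: $$\big|H(x_{n+1/2},v_{n+1/2})-H(x_{1/2},v_{1/2})\big|\le Ch^2\qquad\text{for } nh\le ch^{-N+2},$$ where the constant $c$ is independent of $h$, and $C$ is a constant independent of $n$ and $h$ as long as $nh\le ch^{-N+2}$.
   Context: System ($\varepsilon=1$): $\ddot x(t)=\dot x(t)\times B(x(t))+F(x(t))$, $x(t)\in\mathbb{R}^3$, $v:=\dot x$, with $B(x)=B_0+B_1(x)$, where $B_0\in\mathbb{R}^3$ is a fixed vector with $|B_0|=1$ ($|\cdot|$ is the Euclidean norm), $B_1:\mathbb{R}^3\to\mathbb{R}^3$ is a non-constant magnetic field with known vector potential $A_1$, and $F:\mathbb{R}^3\to\mathbb{R}^3$; $B_1$ and $F$ are smooth and bounded, and $F=-\nabla_xU$ with scalar potential $U$. The full vector potential is $A(x)=-\tfrac12 x\times B_0+A_1(x)$, so $B=\nabla_x\times A$. $A'(x)=(\partial_jA_i(x))_{i,j=1}^3$ is the Jacobian. The initial data satisfy $|x(0)|\le\hat C$, $|\dot x(0)|\le\hat C$. Filters: $\tilde B_0$ is the skew-symmetric matrix with $-\tilde B_0v=v\times B_0$ for all $v\in\mathbb{R}^3$; $\operatorname{tanc}(\zeta)=\tan(\zeta)/\zeta$, $\operatorname{sinc}(\zeta)=\sin(\zeta)/\zeta$;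 $$\Psi=I+\big(1-\operatorname{tanc}(\tfrac h2)\big)\tilde B_0^2,\qquad \Phi=I+\big(1-\operatorname{sinc}(\tfrac h2)^{-1}\big)\tilde B_0^2 .$$ Method FVI: $t_n=nh$, $x_0=x(0)$, $v_0=\dot x(0)$, $x_{n\pm1/2}:=(x_n+x_{n\pm1})/2$, and for $n\ge1$ $$x_{n+1}-2x_n+x_{n-1}=\Psi\Big(\tfrac h2A'(x_{n+1/2})^{\intercal}(x_{n+1}-x_n)+\tfrac h2A'(x_{n-1/2})^{\intercal}(x_n-x_{n-1})-h\big(A(x_{n+1/2})-A(x_{n-1/2})\big)+\tfrac{h^2}2\big(F(x_{n+1/2})+F(x_{n-1/2})\big)\Big).$$ The starting value $x_1$ is defined by $x_1=x_0+h\Psi\big(p_0+\tfrac12A'(x_{1/2})^{\intercal}(x_1-x_0)-A(x_{1/2})+\tfrac h2F(x_{1/2})\big)$ with $p_0=v_0+A(x_0)$ and $x_{1/2}=(x_0+x_1)/2$. The velocities are defined for $n\ge0$ by $v_{n+1/2}:=\dfrac{v_{n+1}+v_n}{2}=\Phi\,\dfrac{x_{n+1}-x_n}{h}$. *)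

(* Defs.v *)
From HB Require Import structures.
From mathcomp Require Import all_boot all_order all_algebra.
From mathcomp Require Import all_classical all_reals all_analysis.

Set Implicit Arguments.
Unset Strict Implicit.
Unset Printing Implicit Defensive.

Import Order.TTheory GRing.Theory Num.Theory.
Import numFieldNormedType.Exports.

Local Open Scope ring_scope.

Section VectorCalculus.
Variable R : realType.
Implicit Types u v x : 'cV[R]_3.

(* The norm `|x| of 'cV[R]_3 in the library is the max norm, hence this one. *)
Definition enorm v : R := Num.sqrt (\sum_(i < 3) v i 0 ^+ 2).

(* Index arithmetic in 'I_3 is modulo 3, so (i, i + 1, i + 2) is a cyclic
   permutation of the three axes. *)
Definition cross u v : 'cV[R]_3 :=
  \col_(i < 3) (u (i + 1) 0 * v (i + 2%:R) 0 - u (i + 2%:R) 0 * v (i + 1) 0).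

Definition axis (i : 'I_3) : 'cV[R]_3 := delta_mx i 0.

Definition partial (W : normedModType R) (i : 'I_3) (f : 'cV[R]_3 -> W)
    : 'cV[R]_3 -> W := fun x => 'D_(axis i) f x.

Definition grad (f : 'cV[R]_3 -> R) x : 'cV[R]_3 := \col_(i < 3) partial i f x.

Definition curl (f : 'cV[R]_3 -> 'cV[R]_3) x : 'cV[R]_3 :=
  \col_(i < 3) (partial (i + 1) (fun y => f y (i + 2%:R) 0) x
              - partial (i + 2%:R) (fun y => f y (i + 1) 0) x).

(* Row i, column j is the j-th partial derivative of the i-th component; the
   library's [jacobian] is the transpose, acting on row vectors. *)
Definition Jac (f : 'cV[R]_3 -> 'cV[R]_3) x : 'M[R]_3 :=
  \matrix_(i < 3, j < 3) partial j (fun y => f y i 0) x.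

Fixpoint Ck (W : normedModType R) (k : nat) (f : 'cV[R]_3 -> W) : Prop :=
  if k is k'.+1 then
    (forall x, differentiable f x) /\ (forall i, Ck k' (partial i f))
  else continuous f.

Definition smooth (W : normedModType R) (f : 'cV[R]_3 -> W) : Prop :=
  forall k, Ck k f.

Definition bounded_field (f : 'cV[R]_3 -> 'cV[R]_3) : Prop :=
  exists M : R, forall x, enorm (f x) <= M.

End VectorCalculus.

Section Filters.
Variable R : realType.
Implicit Types z h : R.

Definition tanc z : R := tan z / z.
Definition sinc z : R := sin z / z.

Definition skewmx (b : 'cV[R]_3) : 'M[R]_3 :=
  \matrix_(i < 3, j < 3) cross b (axis R j) i 0.

Lemma skewmxP (b v : 'cV[R]_3) : - (skewmx b *m v) = cross v b.
Proof.
have E (a : 'I_3) : \sum_(j < 3) axis R j a 0 * v j 0 = v a 0.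
  rewrite (bigD1 a) //= big1 => [|j jNa]; rewrite !mxE ?eqxx /= ?mul1r ?addr0 //.
  by rewrite eq_sym (negbTE jNa) mul0r.
apply/colP => i; rewrite !mxE.
under eq_bigr do rewrite 2!mxE mulrBl -!mulrA.
by rewrite sumrB -!mulr_sumr !E opprB ![b _ _ * _]mulrC.
Qed.

Definition Psi (B0 : 'cV[R]_3) h : 'M[R]_3 :=
  1%:M + (1 - tanc (h / 2)) *: (skewmx B0 *m skewmx B0).

Definition Phi (B0 : 'cV[R]_3) h : 'M[R]_3 :=
  1%:M + (1 - (sinc (h / 2))^-1) *: (skewmx B0 *m skewmx B0).

End Filters.

Section Method.
Variable R : realType.
Implicit Types (A F : 'cV[R]_3 -> 'cV[R]_3).

(* The potential of the full field B0 + curl A1. *)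
Definition full_potential (B0 : 'cV[R]_3) (A1 : 'cV[R]_3 -> 'cV[R]_3) :
    'cV[R]_3 -> 'cV[R]_3 :=
  fun x => - 2^-1 *: cross x B0 + A1 x.

(* [mid x n] is x_{n+1/2}. *)
Definition mid (x : nat -> 'cV[R]_3) (n : nat) : 'cV[R]_3 := 2^-1 *: (x n + x n.+1).

Definition FVI_start (B0 : 'cV[R]_3) A F (h : R) (v0 : 'cV[R]_3)
    (x : nat -> 'cV[R]_3) : Prop :=
  x 1%N = x 0%N + h *: (Psi B0 h *m
    (v0 + A (x 0%N)
     + 2^-1 *: ((Jac A (mid x 0))^T *m (x 1%N - x 0%N))
     - A (mid x 0)
     + (h / 2) *: F (mid x 0))).

(* The two-step relation at the index n + 1. *)
Definition FVI_step (B0 : 'cV[R]_3) A F (h : R)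
    (x : nat -> 'cV[R]_3) (n : nat) : Prop :=
  x n.+2 - 2 *: x n.+1 + x n = Psi B0 h *m
    ((h / 2) *: ((Jac A (mid x n.+1))^T *m (x n.+2 - x n.+1))
     + (h / 2) *: ((Jac A (mid x n))^T *m (x n.+1 - x n))
     - h *: (A (mid x n.+1) - A (mid x n))
     + (h ^+ 2 / 2) *: (F (mid x n.+1) + F (mid x n))).

Definition FVI_velocity (B0 : 'cV[R]_3) (h : R)
    (x v : nat -> 'cV[R]_3) (n : nat) : Prop :=
  mid v n = Phi B0 h *m (h^-1 *: (x n.+1 - x n)).

Definition FVI (B0 : 'cV[R]_3) A F (h : R) (x0 v0 : 'cV[R]_3)
    (x v : nat -> 'cV[R]_3) : Prop :=
  [/\ x 0%N = x0, v 0%N = v0, FVI_start B0 A F h v0 x,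
      forall n, FVI_step B0 A F h x n
    & forall n, FVI_velocity B0 h x v n].

Definition energy (U : 'cV[R]_3 -> R) (x v : 'cV[R]_3) : R :=
  2^-1 * enorm v ^+ 2 + U x.

End Method.

(* Main.v *)
Require Import Defs.
From HB Require Import structures.
From mathcomp Require Import all_boot all_order all_algebra.
From mathcomp Require Import all_classical all_reals all_analysis.
From mathcomp Require Import zify ring lra.
Import Order.TTheory GRing.Theory Num.Theory.
Import numFieldNormedType.Exports.
Set Implicit Arguments.
Unset Strict Implicit.
Unset Printing Implicit Defensive.
Local Open Scope ring_scope.

(** The two-step relation is the discrete Euler-Lagrange equation of an
    autonomous discrete Lagrangian, with the inverse of the filter Psi as mass
    matrix. Invariance under translations in time therefore gives, by a
    discrete Noether argument, a modified energy that is conserved up to any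
    prescribed power of h and differs from the energy by O(h^2). The argument
    works directly on the grid, with neither a modified differential equation
    nor its flow.

    Smoothness in time is expressed by expansions: a sequence a_r depending on
    a run of stepsize h is regular to order m when a_r = Q(r h) + O(h^m) for a
    polynomial Q with coefficients bounded over all runs. Expansions pass to
    products, to shifts, to divided differences (with the loss of one order)
    and, by Taylor's formula, to compositions with smooth fields. Summation
    gains an order. Hence a bounded numerical solution with bounded initial
    velocity has expansions of every order [solution_expands]: put the
    expansion known so far into the right-hand side of the two-step relation
    and sum twice.

    Choose weights w_0, ..., w_N such that D a = (sum_r w_r a_r) / h is the
    derivative at the first node for all polynomials of degree at most N. On
    sequences with an expansion, D obeys the Leibniz and chain rules up to
    O(h^N) [grid_derivM], [grid_deriv_comp]. Applied to the Lagrangian l_r of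
    the r-th grid interval this gives Noether's identity [lagrangian_deriv]

      h D l = p_1 . D x_1 - p_0 . D x_0 + O(h^(N+1)),

    where p_r is the discrete momentum at the r-th node and D x_r the grid
    derivative of the positions from that node on. As the weights sum to zero,
    h D l is the increment of a weighted sum of the l_r; subtracting that sum
    from p_0 . D x_0 gives the modified energy, whose change in one step is
    O(h^(N+1)) [modified_energy_drift]. Solving the identity for the first
    order part of the weighted sum shows that the modified energy is the mean
    of p_0 . D x_0 and p_1 . D x_1 minus l_0, up to O(h^2). This is symmetric
    about the half step and equals |v|^2/2 + U up to O(h^2)
    [modified_energy_value]; as the filter Phi is within O(h^2) of the
    identity, so does the energy of the theorem [energy_value].

    Over n <= c h^(1-N) steps the drift adds up to O(h^2). The constants depend
    on a bound of the velocities, which is propagated by induction on n: the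
    energy bounds the velocity at step n, the two-step relation bounds the
    growth of the velocity in one step independently of its size
    [velocity_increment_bounded], and the estimates for runs with this larger
    velocity bound give the energy at step n + 1 [energy_drift]. *)

(** * Powers of the stepsize *)

Section Asymptotics.
Variables (R : realType) (I : Type) (h : I -> R).
Hypothesis h_gt0 : forall i, 0 < h i.
Hypothesis h_le1 : forall i, h i <= 1.

(** The index ranges over numerical runs, each with its own stepsize; asking
    for one constant valid for all of them is what keeps the final bound
    independent of the run. *)
Definition bigO (m : nat) (a : I -> R) : Prop :=
  exists C : R, forall i, `|a i| <= C * h i ^+ m.

Lemma bigO_ext m a b : (forall i, a i = b i) -> bigO m b -> bigO m a.
Proof. by move=> ab [C bC]; exists C => i; rewrite ab. Qed.

Lemma bigO_cst (c : R) : bigO 0 (fun=> c).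
Proof. by exists `|c| => i; rewrite expr0 mulr1. Qed.

Lemma bigO_zero m : bigO m (fun=> 0).
Proof. by exists 0 => i; rewrite normr0 mul0r. Qed.

Lemma bigO_add m a b : bigO m a -> bigO m b -> bigO m (fun i => a i + b i).
Proof.
move=> [C aC] [D bD]; exists (C + D) => i.
by rewrite (le_trans (ler_normD _ _))// mulrDl lerD.
Qed.

Lemma bigO_opp m a : bigO m a -> bigO m (fun i => - a i).
Proof. by move=> [C aC]; exists C => i; rewrite normrN. Qed.

Lemma bigO_sub m a b : bigO m a -> bigO m b -> bigO m (fun i => a i - b i).
Proof. by move=> aO bO; apply: bigO_add => //; exact: bigO_opp. Qed.

Lemma bigO_mul m n a b :
  bigO m a -> bigO n b -> bigO (m + n) (fun i => a i * b i).
Proof.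
move=> [C aC] [D bD]; exists (C * D) => i.
by rewrite normrM exprD mulrACA ler_pM.
Qed.

Lemma bigO_mull m a b : bigO 0 a -> bigO m b -> bigO m (fun i => a i * b i).
Proof. exact: (@bigO_mul 0 m). Qed.

Lemma bigO_mulr m a b : bigO m a -> bigO 0 b -> bigO m (fun i => a i * b i).
Proof. by rewrite -{2}[m]addn0; exact: bigO_mul. Qed.

Lemma bigO_scale m (c : R) a : bigO m a -> bigO m (fun i => c * a i).
Proof. by apply: bigO_mull; exact: bigO_cst. Qed.

Lemma bigO_sum (J : Type) m (s : seq J) (P : pred J) (a : J -> I -> R) :
  (forall j, P j -> bigO m (a j)) -> bigO m (fun i => \sum_(j <- s | P j) a j i).
Proof.
move=> aO; elim: s => [|j s IHs].
  by apply: bigO_ext (bigO_zero m) => i; rewrite big_nil.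
have [Pj|NPj] := boolP (P j); last first.
  by apply: bigO_ext IHs => i; rewrite big_cons (negbTE NPj).
by apply: bigO_ext (bigO_add (aO _ Pj) IHs) => i; rewrite big_cons Pj.
Qed.

Lemma bigO_step : bigO 1 h.
Proof. by exists 1 => i; rewrite expr1 mul1r ger0_norm// ltW. Qed.

Lemma bigO_stepX m : bigO m (fun i => h i ^+ m).
Proof. by exists 1 => i; rewrite mul1r ger0_norm// exprn_ge0// ltW. Qed.

Lemma bigO_weaken m n a : (m <= n)%N -> bigO n a -> bigO m a.
Proof.
move=> mn [C aC]; exists `|C| => i; apply: le_trans (aC i) _.
have hn0 : 0 <= h i ^+ n by rewrite exprn_ge0// ltW.
apply: le_trans (ler_wpM2r hn0 (ler_norm C)) _.
by apply: ler_wpM2l => //; rewrite ler_wiXn2l// ltW.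
Qed.

Lemma bigO_bounded m a : bigO m a -> bigO 0 a.
Proof. exact: bigO_weaken. Qed.

Lemma bigO_bounded_step : bigO 0 h. Proof. exact: bigO_bounded bigO_step. Qed.

Lemma bigO_div m a : bigO m.+1 a -> bigO m (fun i => (h i)^-1 * a i).
Proof.
move=> [C aC]; exists C => i.
have h0 := h_gt0 i.
by rewrite normrM gtr0_norm ?invr_gt0// ler_pdivrMl// mulrCA -exprS.
Qed.

Lemma bigO_exp (a : I -> R) k : bigO 0 a -> bigO 0 (fun i => a i ^+ k).
Proof.
move=> a0; elim: k => [|k IHk].
  by apply: bigO_ext (bigO_cst 1) => i; rewrite expr0.
by apply: bigO_ext (bigO_mull a0 IHk) => i; rewrite exprS.
Qed.

Definition eqO m (a b : I -> R) := bigO m (fun i => a i - b i).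

Lemma eqO_refl m a : eqO m a a.
Proof. by apply: bigO_ext (bigO_zero m) => i; rewrite subrr. Qed.

Lemma eqO_eq m a b : (forall i, a i = b i) -> eqO m a b.
Proof. by move=> ab; apply: bigO_ext (bigO_zero m) => i; rewrite ab subrr. Qed.

Lemma eqO_sym m a b : eqO m a b -> eqO m b a.
Proof. by move=> /bigO_opp; apply: bigO_ext => i; rewrite opprB. Qed.

Lemma eqO_trans m b a c : eqO m a b -> eqO m b c -> eqO m a c.
Proof.
by move=> ab bc; apply: bigO_ext (bigO_add ab bc) => i; rewrite addrA subrK.
Qed.

Lemma eqO_add m a b c d :
  eqO m a b -> eqO m c d -> eqO m (fun i => a i + c i) (fun i => b i + d i).
Proof.
move=> ab cd; apply: bigO_ext (bigO_add ab cd) => i.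
by rewrite addrACA opprD.
Qed.

Lemma eqO_opp m a b : eqO m a b -> eqO m (fun i => - a i) (fun i => - b i).
Proof. by move=> /bigO_opp; apply: bigO_ext => i; rewrite opprD. Qed.

Lemma eqO_mull m c a b :
  bigO 0 c -> eqO m a b -> eqO m (fun i => c i * a i) (fun i => c i * b i).
Proof.
by move=> c0 ab; apply: bigO_ext (bigO_mull c0 ab) => i; rewrite mulrBr.
Qed.

Lemma eqO_sum (J : Type) m (s : seq J) (P : pred J) (a b : J -> I -> R) :
  (forall j, P j -> eqO m (a j) (b j)) ->
  eqO m (fun i => \sum_(j <- s | P j) a j i) (fun i => \sum_(j <- s | P j) b j i).
Proof.
by move=> ab; apply: bigO_ext (bigO_sum s ab) => i; rewrite sumrB.
Qed.

Lemma eqO_bigO m a b : eqO m a b -> bigO m b -> bigO m a.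
Proof. by move=> ab b0; apply: bigO_ext (bigO_add ab b0) => i; rewrite subrK. Qed.

(** * Expansions along the grid *)

Definition bpoly (Q : I -> {poly R}) : Prop :=
  (exists d, forall i, (size (Q i) <= d)%N) /\
  forall k, bigO 0 (fun i => (Q i)`_k).

Lemma bpolyC c : bigO 0 c -> bpoly (fun i => (c i)%:P).
Proof.
move=> c0; split; first by exists 1 => i; exact: size_polyC_leq1.
case=> [|k]; last by apply: bigO_ext (bigO_zero 0) => i; rewrite coefC.
by apply: bigO_ext c0 => i; rewrite coefC.
Qed.

Lemma bpolyX : bpoly (fun=> 'X).
Proof.
split; first by exists 2 => i; rewrite size_polyX.
by move=> k; exact: bigO_cst.
Qed.

Lemma bpolyD P Q : bpoly P -> bpoly Q -> bpoly (fun i => P i + Q i).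
Proof.
move=> [[d Pd] P0] [[e Qe] Q0]; split.
  exists (maxn d e) => i; apply: leq_trans (size_polyD _ _) _.
  by rewrite geq_max !leq_max Pd Qe orbT.
by move=> k; apply: bigO_ext (bigO_add (P0 k) (Q0 k)) => i; rewrite coefD.
Qed.

Lemma bpolyM P Q : bpoly P -> bpoly Q -> bpoly (fun i => P i * Q i).
Proof.
move=> [[d Pd] P0] [[e Qe] Q0]; split.
  exists (d + e)%N => i; apply: leq_trans (size_polyMleq _ _) _.
  by apply: leq_trans (leq_pred _) _; exact: leq_add.
move=> k; apply: (@bigO_ext _ _
    (fun i => \sum_(j < k.+1) (P i)`_j * (Q i)`_(k - j))).
  by move=> i; rewrite coefM.
by apply: bigO_sum => j _; exact: bigO_mull.
Qed.

(** Node values of polynomials with uniformly bounded coefficients. They are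
    closed under products, shifts and divided differences, and stand in for
    smooth interpolants of the grid data. *)
Definition exact (a : I -> nat -> R) : Prop :=
  exists2 Q, bpoly Q & forall i r, a i r = (Q i).[r%:R * h i].

Lemma exact_ext a b : (forall i r, a i r = b i r) -> exact b -> exact a.
Proof. by move=> ab [Q Q0 bQ]; exists Q => // i r; rewrite ab. Qed.

Lemma exact_cst c : bigO 0 c -> exact (fun i _ => c i).
Proof.
by move=> c0; exists (fun i => (c i)%:P) => [|i r]; [exact: bpolyC|rewrite hornerC].
Qed.

Lemma exact_node : exact (fun i r => r%:R * h i).
Proof. by exists (fun=> 'X) => [|i r]; [exact: bpolyX|rewrite hornerX]. Qed.

Lemma exact_add a b : exact a -> exact b -> exact (fun i r => a i r + b i r).
Proof.
move=> [P P0 aP] [Q Q0 bQ]; exists (fun i => P i + Q i); first exact: bpolyD.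
by move=> i r; rewrite hornerD aP bQ.
Qed.

Lemma exact_mul a b : exact a -> exact b -> exact (fun i r => a i r * b i r).
Proof.
move=> [P P0 aP] [Q Q0 bQ]; exists (fun i => P i * Q i); first exact: bpolyM.
by move=> i r; rewrite hornerM aP bQ.
Qed.

Lemma exact_sum (J : Type) (s : seq J) (a : J -> I -> nat -> R) :
  (forall j, exact (a j)) -> exact (fun i r => \sum_(j <- s) a j i r).
Proof.
move=> aE; elim: s => [|j s IHs].
  apply: (@exact_ext _ (fun _ _ => 0)); first by move=> i r; rewrite big_nil.
  exact: (exact_cst (bigO_zero 0)).
by apply: exact_ext (exact_add (aE j) IHs) => i r; rewrite big_cons.
Qed.

Lemma exact_exp a k : exact a -> exact (fun i r => a i r ^+ k).
Proof.
move=> aE; elim: k => [|k IHk].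
  apply: (@exact_ext _ (fun _ _ => 1)) => [i r|]; first by rewrite expr0.
  exact: exact_cst (bigO_cst 1).
by apply: exact_ext (exact_mul aE IHk) => i r; rewrite exprS.
Qed.

Lemma exact_bounded a r : exact a -> bigO 0 (a ^~ r).
Proof.
move=> [Q [[d Qd] Q0] aQ].
apply: (@bigO_ext _ _ (fun i => \sum_(k < d) (Q i)`_k * (r%:R * h i) ^+ k)).
  by move=> i; rewrite aQ (horner_coef_wide _ (Qd i)).
apply: bigO_sum => k _; apply: bigO_mull => //; apply: bigO_exp.
by apply: bigO_scale; exact: bigO_bounded_step.
Qed.

Lemma exact_monomials a : exact a -> exists d (q : nat -> I -> R),
  (forall k, bigO 0 (q k)) /\
  forall i r, a i r = \sum_(k < d) q k i * (r%:R * h i) ^+ k.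
Proof.
move=> [Q [[d Qd] Q0] aQ]; exists d, (fun k i => (Q i)`_k); split => // i r.
by rewrite aQ (horner_coef_wide _ (Qd i)).
Qed.

Lemma nodeS i r : r.+1%:R * h i = r%:R * h i + h i.
Proof. by rewrite -natr1 mulrDl mul1r. Qed.

Lemma exact_shift a : exact a -> exact (fun i r => a i r.+1).
Proof.
move=> /exact_monomials[d [q [q0 aq]]].
apply: (@exact_ext _
    (fun i r => \sum_(k < d) q k i * (r%:R * h i + h i) ^+ k)).
  by move=> i r; rewrite aq nodeS.
apply: exact_sum => k; apply: exact_mul; first exact: exact_cst.
apply: exact_exp; apply: exact_add; first exact: exact_node.
exact: exact_cst bigO_bounded_step.
Qed.

Lemma exact_quotient a :
  exact a -> exact (fun i r => (h i)^-1 * (a i r.+1 - a i r)).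
Proof.
move=> /exact_monomials[d [q [q0 aq]]].
apply: (@exact_ext _ (fun i r => \sum_(k < d) q k i *
    \sum_(j < k) (r%:R * h i + h i) ^+ (k.-1 - j) * (r%:R * h i) ^+ j)).
  move=> i r; rewrite !aq -sumrB mulr_sumr; apply: eq_bigr => k _.
  by rewrite -mulrBr mulrCA nodeS subrXX addrAC subrr add0r mulKf ?gt_eqF.
apply: exact_sum => k; apply: exact_mul; first exact: exact_cst.
apply: exact_sum => j; apply: exact_mul; apply: exact_exp; last exact: exact_node.
apply: exact_add; first exact: exact_node.
exact: exact_cst bigO_bounded_step.
Qed.

(** The difference of t^(d+1) has leading term (d+1) h t^d, so the leading
    coefficient can be integrated and the rest is of lower degree. *)
Lemma exact_antidifference b : exact b ->
  exists2 a, exact a & forall i r, a i r.+1 - a i r = h i * b i r.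
Proof.
move=> /exact_monomials[d [q [q0 bq]]].
suff [a aE ab] : exists2 a, exact a & forall i r,
    a i r.+1 - a i r = h i * \sum_(k < d) q k i * (r%:R * h i) ^+ k.
  by exists a => // i r; rewrite bq ab.
elim: d q q0 {b bq} => [|d IHd] q q0.
  exists (fun _ _ => 0); first exact: (exact_cst (bigO_zero 0)).
  by move=> i r; rewrite big_ord0 subrr mulr0.
pose c i := q d i / d.+1%:R.
have c0 : bigO 0 c.
  by apply: bigO_mulr => //; exact: (bigO_cst (d.+1%:R^-1)).
(* Subtracting the difference of c t^(d+1) cancels the term of degree d. *)
have [|a aE ab] := IHd (fun k i => q k i - c i * (h i ^+ (d - k) *+ 'C(d.+1, k))).
  move=> k; apply: bigO_sub => //; apply: bigO_mull => //.
  apply: (@bigO_ext _ _ (fun i => 'C(d.+1, k)%:R * h i ^+ (d - k))).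
    by move=> i; rewrite mulr_natl.
  by apply: bigO_scale; apply: bigO_exp; exact: bigO_bounded_step.
exists (fun i r => a i r + c i * (r%:R * h i) ^+ d.+1).
  apply: exact_add => //; apply: exact_mul; first exact: exact_cst.
  by apply: exact_exp; exact: exact_node.
move=> i r; rewrite opprD addrACA ab -mulrBr nodeS.
set t := _ * h i; rewrite [t + h i]addrC exprDn big_ord_recr/= subnn.
rewrite expr0 mul1r binn mulr1n addrK.
rewrite !big_ord_recr/= mulrDr subSnn expr1 binSn.
under eq_bigr do rewrite mulrBl.
rewrite sumrB mulrBr !mulrDr.
have -> : c i * \sum_(j < d) h i ^+ (d.+1 - j) * t ^+ j *+ 'C(d.+1, j) =
    h i * \sum_(j < d) c i * (h i ^+ (d - j) *+ 'C(d.+1, j)) * t ^+ j.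
  rewrite !mulr_sumr; apply: eq_bigr => j _.
  rewrite (subSn (ltnW (ltn_ord j))) exprS.
  by rewrite !(mulrnAr, mulrnAl); congr (_ *+ _); ring.
rewrite addrA subrK; congr (_ + _); rewrite /c -(mulr_natr (h i * _)).
have : d.+1%:R != 0 :> R by rewrite pnatr_eq0.
by move: (d.+1%:R) => D D0; field.
Qed.

(** Smoothness in time, up to order m, of a family of sequences. The constant
    of the remainder may depend on the node r, since only boundedly many nodes
    ever enter one estimate. *)
Definition expands m (a : I -> nat -> R) : Prop :=
  exists2 b, exact b & forall r, eqO m (a ^~ r) (b ^~ r).

Lemma expands_ext m a b :
  (forall i r, a i r = b i r) -> expands m b -> expands m a.
Proof.
move=> ab [c cE bc]; exists c => // r; apply: eqO_trans (bc r).
by apply: eqO_eq => i; rewrite ab.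
Qed.

Lemma exact_expands m a : exact a -> expands m a.
Proof. by move=> aE; exists a => // r; exact: eqO_refl. Qed.

Lemma expands_cst m c : bigO 0 c -> expands m (fun i _ => c i).
Proof. by move=> c0; apply/exact_expands/exact_cst. Qed.

Lemma expands_weaken m n a : (m <= n)%N -> expands n a -> expands m a.
Proof. by move=> mn [b bE ab]; exists b => // r; exact: bigO_weaken (ab r). Qed.

Lemma expands_bounded m a r : expands m a -> bigO 0 (a ^~ r).
Proof.
by move=> [b bE ab]; apply: eqO_bigO (bigO_bounded (ab r)) _; exact: exact_bounded.
Qed.

Lemma expands0 a : (forall r, bigO 0 (a ^~ r)) -> expands 0 a.
Proof.
move=> a0; exists (fun _ _ => 0); first exact: (exact_cst (bigO_zero 0)).
by move=> r; apply: bigO_ext (a0 r) => i; rewrite subr0.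
Qed.

Lemma expands_add m a b :
  expands m a -> expands m b -> expands m (fun i r => a i r + b i r).
Proof.
move=> [c cE ac] [d dE bd]; exists (fun i r => c i r + d i r).
  exact: exact_add.
by move=> r; exact: eqO_add.
Qed.

Lemma expands_mul m a b :
  expands m a -> expands m b -> expands m (fun i r => a i r * b i r).
Proof.
move=> [c cE ac] bX; have [d dE bd] := bX; exists (fun i r => c i r * d i r).
  exact: exact_mul.
move=> r; apply: (eqO_trans (b := fun i => b i r * c i r)).
  apply: bigO_ext (bigO_mull (expands_bounded r bX) (ac r)) => i.
  by rewrite mulrBr mulrC.
apply: bigO_ext (bigO_mull (exact_bounded r cE) (bd r)) => i.
by rewrite mulrBr mulrC.
Qed.

Lemma expands_mulc m c a :
  bigO 0 c -> expands m a -> expands m (fun i r => c i * a i r).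
Proof. by move=> c0; apply: expands_mul; exact: expands_cst. Qed.

Lemma expands_scale m (c : R) a : expands m a -> expands m (fun i r => c * a i r).
Proof. by apply: expands_mulc; exact: bigO_cst. Qed.

Lemma expands_opp m a : expands m a -> expands m (fun i r => - a i r).
Proof.
by move=> aX; apply: expands_ext (expands_scale (-1) aX) => i r; rewrite mulN1r.
Qed.

Lemma expands_sub m a b :
  expands m a -> expands m b -> expands m (fun i r => a i r - b i r).
Proof. by move=> aX bX; apply: expands_add => //; exact: expands_opp. Qed.

Lemma expands_sum (J : Type) m (s : seq J) (a : J -> I -> nat -> R) :
  (forall j, expands m (a j)) -> expands m (fun i r => \sum_(j <- s) a j i r).
Proof.
move=> aE; elim: s => [|j s IHs].
  apply: (@expands_ext _ _ (fun _ _ => 0)); first by move=> i r; rewrite big_nil.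
  exact: (expands_cst m (bigO_zero 0)).
by apply: expands_ext (expands_add (aE j) IHs) => i r; rewrite big_cons.
Qed.

Lemma expands_shift m a : expands m a -> expands m (fun i r => a i r.+1).
Proof.
move=> [b bE ab]; exists (fun i r => b i r.+1); first exact: exact_shift.
by move=> r; exact: ab.
Qed.

Lemma expands_quotient m a : expands m.+1 a ->
  expands m (fun i r => (h i)^-1 * (a i r.+1 - a i r)).
Proof.
move=> [b bE ab]; exists (fun i r => (h i)^-1 * (b i r.+1 - b i r)).
  exact: exact_quotient.
move=> r; apply: bigO_ext (bigO_div (eqO_add (ab r.+1) (eqO_opp (ab r)))) => i.
by rewrite -mulrBr.
Qed.

(** Summation gains one power of h: this is what lets a difference equation
    improve the expansion of its own solutions. *)
Lemma expands_antidifference m a b :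
  bigO 0 (a ^~ 0%N) -> expands m b ->
  (forall i r, a i r.+1 - a i r = h i * b i r) -> expands m.+1 a.
Proof.
move=> a0 [c cE bc] ab; have [d dE dc] := exact_antidifference cE.
exists (fun i r => d i r + (a i 0 - d i 0)).
  apply: exact_add => //; apply: exact_cst; apply: bigO_sub => //.
  exact: exact_bounded.
elim=> [|r IHr]; first by apply: eqO_eq => i; ring.
apply: bigO_ext (bigO_add IHr (bigO_mul bigO_step (bc r))) => i /=.
by rewrite mulrBr -ab -dc; ring.
Qed.

(** A sequence with bounded divided differences moves by O(h) per node. *)
Lemma expands_increment m a r : expands m a -> (0 < m)%N ->
  eqO 1 (a ^~ r) (a ^~ 0%N).
Proof.
case: m => // m aX _; elim: r => [|r IHr]; first exact: eqO_refl.
apply: eqO_trans IHr.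
have q0 : bigO 0 (fun i => (h i)^-1 * (a i r.+1 - a i r)).
  exact: (expands_bounded r (expands_quotient aX)).
by apply: bigO_ext (bigO_mul bigO_step q0) => i; rewrite mulVKf// gt_eqF.
Qed.

Lemma expands_eqO m a b :
  (forall r, eqO m (a ^~ r) (b ^~ r)) -> expands m b -> expands m a.
Proof.
by move=> ab [c cE bc]; exists c => // r; exact: eqO_trans (ab r) (bc r).
Qed.

Lemma expands_poly m a : expands m a ->
  exists2 Q, bpoly Q & forall r, eqO m (a ^~ r) (fun i => (Q i).[r%:R * h i]).
Proof.
move=> [b [Q Q0 bQ] ab]; exists Q => // r.
by apply: eqO_trans (ab r) _; apply: eqO_eq => i.
Qed.

(** * Finite-difference functionals *)

(** A weighted sum of grid values sees the coefficients of the polynomial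
    through the moments of the weights; as the k-th coefficient comes with
    h^k, the first m moments decide the sum up to O(h^m). *)
Lemma bpoly_weighted m Q n (c : nat -> R) : bpoly Q ->
  eqO m (fun i => \sum_(r < n) c r * (Q i).[r%:R * h i])
    (fun i => \sum_(k < m) (\sum_(r < n) c r * r%:R ^+ k) * ((Q i)`_k * h i ^+ k)).
Proof.
move=> [[d Qd] Q0]; pose mom k := \sum_(r < n) c r * r%:R ^+ k.
apply: (eqO_trans (b := fun i => \sum_(k < m + d) mom k * ((Q i)`_k * h i ^+ k))).
  apply: eqO_eq => i; transitivity (\sum_(r < n) \sum_(k < m + d)
      c r * r%:R ^+ k * ((Q i)`_k * h i ^+ k)).
    apply: eq_bigr => r _.
    rewrite (horner_coef_wide _ (leq_trans (Qd i) (leq_addl m d))) mulr_sumr.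
    by apply: eq_bigr => k _; rewrite exprMn; ring.
  by rewrite exchange_big; apply: eq_bigr => k _; rewrite mulr_suml.
apply: (@bigO_ext _ _ (fun i =>
    \sum_(k < d) mom (m + k)%N * ((Q i)`_(m + k) * h i ^+ (m + k)))).
  by move=> i; rewrite big_split_ord/= addrAC subrr add0r.
apply: bigO_sum => k _; apply: bigO_scale; apply: bigO_mull => //.
by apply: bigO_weaken (bigO_stepX _); exact: leq_addr.
Qed.

Lemma eqO_weighted m n (c : nat -> R) a b :
  (forall r, eqO m (a ^~ r) (b ^~ r)) ->
  eqO m (fun i => \sum_(r < n) c r * a i r) (fun i => \sum_(r < n) c r * b i r).
Proof.
by move=> ab; apply: eqO_sum => r _; apply: eqO_mull => //; exact: bigO_cst.
Qed.

End Asymptotics.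

(** * Taylor expansion of a field on a box *)

(** Boxes are compact and convex, hence contain the half-step points and the
    segments needed for the mean value theorem. *)
Definition box (R : realType) (t : R) (x : 'cV[R]_3) := forall j, `|x j 0| <= t.

Section Taylor.
Variable R : realType.
Local Notation V := 'cV[R]_3.
Implicit Types (f : V -> R) (a d x : V).

Lemma power_rule (c s : R) k :
  is_derive s (1 : R) (fun s : R => c * (s ^+ k.+1 / k.+1`!%:R))
    (c * (s ^+ k / k`!%:R)).
Proof.
have -> : (fun s : R => c * (s ^+ k.+1 / k.+1`!%:R)) =
    (c / k.+1`!%:R) \*: (id ^+ k.+1 : R -> R).
  by apply/funext => t /=; rewrite -[LHS]/(_ * _) fctE mulrA mulrAC.
apply: is_derive_eq.
rewrite /= factS natrM -![_ *: _]/(_ * _) mulr1 invfM.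
have : k.+1%:R != 0 :> R by rewrite pnatr_eq0.
have : k`!%:R != 0 :> R by rewrite pnatr_eq0 -lt0n fact_gt0.
by move: (k.+1%:R) (k`!%:R) => p q p0 q0; field; rewrite p0 q0.
Qed.

(** One application of the mean value theorem per order: the remainder has the
    bounded remainder of one order less as its derivative, and vanishes at 0.
    The factor 1 / m! of the sharp bound is lost. *)
Lemma taylor_line (g : nat -> R -> R) (B : R) m :
  (forall k s, (k < m)%N -> is_derive s (1 : R) (g k) (g k.+1 s)) ->
  (forall s, 0 <= s <= 1 -> `|g m s| <= B) ->
  forall t, 0 <= t <= 1 ->
    `|g 0%N t - \sum_(k < m) g k 0 * (t ^+ k / k`!%:R)| <= B.
Proof.
elim: m g => [|m IHm] g gD gB t t01.
  by rewrite big_ord0 subr0; exact: gB.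
pose r s := g 0%N s - \sum_(k < m.+1) g k 0 * (s ^+ k / k`!%:R).
pose r' s := g 1%N s - \sum_(k < m) g k.+1 0 * (s ^+ k / k`!%:R).
have rD s : is_derive s (1 : R) r (r' s).
  have -> : r = (g 0%N - cst (g 0%N 0)) -
      \sum_(k < m) (fun s => g k.+1 0 * (s ^+ k.+1 / k.+1`!%:R)).
    apply/funext => u; rewrite /r big_ord_recl/= expr0 fact0 divr1 mulr1.
    by rewrite !fctE opprD addrA fct_sumE.
  apply: is_deriveB; last first.
    by apply: is_derive_sum => k; exact: power_rule.
  by rewrite -[g 1%N s]subr0; apply: is_deriveB; exact: gD.
have r'B s : 0 <= s <= 1 -> `|r' s| <= B.
  by apply: (IHm (fun k => g k.+1)) => // k s' km; exact: gD.
have r0 : r 0 = 0.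
  rewrite /r big_ord_recl/= expr0 fact0 divr1 mulr1 big1 ?addr0 ?subrr// => k _.
  by rewrite expr0n/= mul0r mulr0.
have [t0|t0] := eqVneq t 0.
  rewrite t0 -/(r 0) r0 normr0.
  by apply: le_trans (r'B 0 _); rewrite ?lexx ?ler01.
have tgt0 : 0 < t by rewrite lt_neqAle eq_sym t0; case/andP: t01.
have rc : {within `[0, t], continuous r}%classic.
  by apply: derivable_within_continuous => s _; exact: (@ex_derive _ _ _ _ _ _ _ (rD s)).
have [s sI E] := @MVT _ r r' 0 t tgt0 (fun s _ => rD s) rc.
rewrite -/(r t) -[r t]subr0 -r0 E subr0 normrM (ger0_norm (ltW tgt0)).
move: sI; rewrite in_itv/= => /andP[s0 st].
have /r'B rs : 0 <= s <= 1.
  by case/andP: t01 => _ t1; rewrite (ltW s0) (le_trans (ltW st)).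
rewrite (le_trans _ rs)// ler_piMr//.
by case/andP: t01.
Qed.

Lemma line_derive f a d s : differentiable f (a + s *: d) ->
  is_derive s (1 : R) (fun s => f (a + s *: d))
    (\sum_(i < 3) d i 0 * partial i f (a + s *: d)).
Proof.
move=> fd.
pose l := cst a + ( *:%R ^~ d) : R -> V.
have ld : is_diff s l (0 + ( *:%R ^~ d)) by exact: is_diffD.
have fld : differentiable f (l s) by [].
have cd : differentiable (f \o l) s by apply: differentiable_comp.
apply: DeriveDef; first exact: diff_derivable.
have dl : 'd l s = 0 + ( *:%R ^~ d) :> (R -> V) by exact: diff_val.
have axes b : 'd f b d = \sum_(i < 3) d i 0 * 'd f b (axis R i).
  have {1}-> : d = \sum_(i < 3) d i 0 *: axis R i.
    apply/colP => i; rewrite summxE (bigD1 i)//= big1 => [|j ji].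
      by rewrite !mxE !eqxx mulr1 addr0.
    by rewrite !mxE eq_sym (negbTE ji) mulr0.
  by rewrite linear_sum; apply: eq_bigr => i _; rewrite linearZ.
rewrite deriveE// diff_comp// [LHS]/= dl fctE add0r scale1r axes.
by apply: eq_bigr => i _; rewrite /partial deriveE.
Qed.

(** The k-th derivative of f along d; peeling off one partial derivative at a
    time dispenses with multi-indices. *)
Fixpoint dterm k f a d : R :=
  if k is k'.+1 then \sum_(i < 3) d i 0 * dterm k' (partial i f) a d else f a.

Lemma dterm_derive k f a d s : Ck k.+1 f ->
  is_derive s (1 : R) (fun s => dterm k f (a + s *: d) d)
    (dterm k.+1 f (a + s *: d) d).
Proof.
elim: k f => [|k IHk] f [fd fC]; first exact: line_derive.
have -> : (fun s => dterm k.+1 f (a + s *: d) d) =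
    \sum_(i < 3) (d i 0 \*: (fun s => dterm k (partial i f) (a + s *: d) d)).
  by apply/funext => u; rewrite fct_sumE.
by apply: is_derive_sum => i; apply: is_deriveZ; apply: IHk; exact: fC.
Qed.

Lemma continuous_box f (t : R) : continuous f ->
  exists C : R, forall x, box t x -> `|f x| <= C.
Proof.
move=> fc.
have cB : compact [set x : V | box t x]%classic.
  have -> : ([set x : V | box t x] =
      trmx @` [set v : 'rV[R]_3 | forall i, `[- t, t] (v ord0 i)])%classic.
    apply/seteqP; split=> [x xt|_ [v vt <-] j].
      exists x^T; last exact: trmxK.
      by move=> j /=; rewrite mxE in_itv/= -ler_norml.
    by rewrite mxE ler_norml; move: (vt j) => /=; rewrite in_itv.
  apply: continuous_compact; last first.
    by apply: (@rV_compact _ _ (fun=> `[- t, t]%classic)) => _; exact: segment_compact.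
  apply: continuous_subspaceT.
  move=> M s /= /nbhs_ballP[e e0 es].
  apply/nbhs_ballP; exists e => //= N' [_ MN]; apply: es; split => // i j.
  by rewrite !mxE; exact: MN.
have [M [_ MB]] : bounded_set (f @` [set x : V | box t x])%classic.
  apply: compact_bounded; apply: continuous_compact => //.
  exact: continuous_subspaceT.
exists (M + 1) => x xt; apply: (MB (M + 1)); first by rewrite ltrDl.
by exists x.
Qed.

Lemma dterm_box m f (rho : R) : Ck m f -> exists C : R,
  forall a d t, box rho a -> box t d -> `|dterm m f a d| <= C * t ^+ m.
Proof.
elim: m f => [|m IHm] f.
  move=> /(continuous_box rho)[C fC].
  by exists C => a d t aB _; rewrite expr0 mulr1; exact: fC.
move=> [_ fC].
have /choice[C CB] : forall i, exists C : R, forall a d t,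
    box rho a -> box t d -> `|dterm m (partial i f) a d| <= C * t ^+ m.
  by move=> i; apply: IHm; exact: fC.
exists (\sum_(i < 3) C i) => a d t aB dB /=.
rewrite (le_trans (ler_norm_sum _ _ _))// mulr_suml ler_sum// => i _.
by rewrite normrM exprS mulrCA ler_pM//; exact: CB.
Qed.

Lemma Ck_le (W : normedModType R) m n (f : V -> W) :
  (m <= n)%N -> Ck n f -> Ck m f.
Proof.
elim: n m f => [|n IHn] [|m] f //= mn.
    by move=> [fd _] x; exact: differentiable_continuous (fd x).
by move=> [fd fC]; split=> // i; apply: IHn => //; exact: fC.
Qed.

Lemma taylor_box m f (rho : R) : Ck m f -> exists C : R,
  forall a d t, box rho a -> box rho (a + d) -> box t d ->
    `|f (a + d) - \sum_(k < m) dterm k f a d / k`!%:R| <= C * t ^+ m.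
Proof.
move=> fC; have [C CB] := dterm_box rho fC; exists C => a d t aB adB dB.
have line := @taylor_line (fun k s => dterm k f (a + s *: d) d) (C * t ^+ m) m.
have := line _ _ 1; rewrite scale1r /=.
under eq_bigr do rewrite scale0r addr0 expr1n div1r.
apply; last by rewrite ler01 lexx.
  by move=> k s km; apply: dterm_derive; exact: Ck_le fC.
move=> s /andP[s0 s1]; apply: CB => // j.
have -> : (a + s *: d) j 0 = (1 - s) * a j 0 + s * (a + d) j 0.
  by rewrite !mxE; ring.
apply: le_trans (ler_normD _ _) _.
have s10 : 0 <= 1 - s by rewrite subr_ge0.
rewrite !normrM (ger0_norm s0) (ger0_norm s10).
rewrite [leRHS](_ : _ = (1 - s) * rho + s * rho); last by ring.
by rewrite lerD// ler_wpM2l.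
Qed.

End Taylor.
(** * Differentiation along the grid *)

(** The moment conditions form a linear system whose matrix is the Vandermonde
    matrix of the distinct nodes 0, ..., N. *)
Lemma derivative_weights (R : realType) N : exists w : nat -> R,
  forall k, (k <= N)%N -> \sum_(r < N.+1) w r * r%:R ^+ k = (k == 1)%:R.
Proof.
pose a : 'rV[R]_N.+1 := \row_j j%:R.
have Vu : Vandermonde N.+1 a \in unitmx.
  rewrite unitmxE det_Vandermonde unitfE.
  apply/prodf_neq0 => i _; apply/prodf_neq0 => j ij.
  by rewrite !mxE subr_eq0 eqr_nat gtn_eqF.
pose e : 'cV[R]_N.+1 := \col_j (j == 1%N :> nat)%:R.
pose w := invmx (Vandermonde N.+1 a) *m e.
exists (fun r => w (inord r) 0) => k kN.
have /colP/(_ (inord k)) : Vandermonde N.+1 a *m w = e by rewrite mulKVmx.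
rewrite !mxE inordK// => <-; apply: eq_bigr => r _.
by rewrite !mxE inordK// inord_val mulrC.
Qed.

Section GridDerivative.
Variables (R : realType) (I : Type) (h : I -> R).
Hypothesis h_gt0 : forall i, 0 < h i.
Hypothesis h_le1 : forall i, h i <= 1.
Local Notation V := 'cV[R]_3.

Lemma expands_dterm k m (f : V -> R) (a : I -> V) (d : I -> nat -> V)
    (rho : R) :
  Ck k f -> (forall i, box rho (a i)) ->
  (forall j, expands h m (fun i r => d i r j 0)) ->
  expands h m (fun i r => dterm k f (a i) (d i r)).
Proof.
move=> + aB dX; elim: k f => [|k IHk] f.
  move=> /(continuous_box rho)[C fC]; apply: expands_cst => //.
  by exists C => i; rewrite expr0 mulr1; exact: fC.
move=> [_ fC]; apply: expands_sum => // j; apply: expands_mul => //.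
by apply: IHk; exact: fC.
Qed.

Lemma eqO_taylor m (f : V -> R) (x : I -> nat -> V) (rho : R) :
  Ck m.+1 f -> (forall i r, box rho (x i r)) ->
  (forall j, expands h m.+1 (fun i r => x i r j 0)) ->
  forall r, eqO h m.+1 (fun i => f (x i r))
    (fun i => \sum_(k < m.+1) dterm k f (x i 0%N) (x i r - x i 0%N) / k`!%:R).
Proof.
move=> fC xB xX r; have [C CB] := taylor_box rho fC.
have /choice[D DB] : forall j, exists D : R, forall i,
    `|(x i r - x i 0%N) j 0| <= D * h i ^+ 1.
  move=> j; have [D DB] := expands_increment h_gt0 h_le1 r (xX j) isT.
  by exists D => i; rewrite !mxE; exact: DB.
pose D0 := \sum_j `|D j|.
exists (C * D0 ^+ m.+1) => i; rewrite -mulrA -exprMn.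
rewrite -{1}[x i r](subrKC (x i 0%N)); apply: CB => //.
  by rewrite subrKC.
move=> j; apply: le_trans (DB j i) _; rewrite expr1 ler_wpM2r ?(ltW (h_gt0 i))//.
rewrite (le_trans (ler_norm _))// /D0 (bigD1 j)//= lerDl.
exact: sumr_ge0.
Qed.

(** The Taylor polynomial at the first grid point is a polynomial in the
    increments, and the increments are O(h). *)
Lemma expands_comp m (f : V -> R) (x : I -> nat -> V) (rho : R) :
  smooth f -> (forall i r, box rho (x i r)) ->
  (forall j, expands h m (fun i r => x i r j 0)) ->
  expands h m (fun i r => f (x i r)).
Proof.
case: m => [|m] fC xB xX.
  apply: expands0 => // r; have [C CB] := continuous_box rho (fC 0%N).
  by exists C => i; rewrite expr0 mulr1; exact: CB.
apply: (expands_eqO (eqO_taylor (fC _) xB xX)).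
apply: expands_sum => // k; apply: expands_mul => //; last first.
  by apply: expands_cst => //; exact: bigO_cst.
apply: (expands_dterm _ (fun i => xB i 0%N)); first exact: fC.
move=> j; apply: (@expands_ext _ _ _ _ _ (fun i r => x i r j 0 - x i 0%N j 0)).
  by move=> i r; rewrite !mxE.
apply: expands_sub => //; apply: expands_cst => //.
exact: (expands_bounded h_gt0 h_le1 0 (xX j)).
Qed.

Variables (N : nat) (w : nat -> R).
Hypothesis N_gt0 : (0 < N)%N.
Hypothesis w_moments :
  forall k, (k <= N)%N -> \sum_(r < N.+1) w r * r%:R ^+ k = (k == 1)%:R.

(** The one-sided difference formula for the derivative at the first node,
    exact on polynomials of degree at most N. *)
Definition grid_deriv (t : R) (a : nat -> R) : R :=
  t^-1 * \sum_(r < N.+1) w r * a r.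

Lemma grid_deriv_ext t a b : (forall r, a r = b r) ->
  grid_deriv t a = grid_deriv t b.
Proof. by move=> ab; congr (_ * _); apply: eq_bigr => r _; rewrite ab. Qed.

Lemma grid_derivD t a b :
  grid_deriv t (fun r => a r + b r) = grid_deriv t a + grid_deriv t b.
Proof.
rewrite /grid_deriv -mulrDr -big_split/=; congr (_ * _).
by apply: eq_bigr => r _; rewrite mulrDr.
Qed.

Lemma grid_derivZ t c a : grid_deriv t (fun r => c * a r) = c * grid_deriv t a.
Proof.
rewrite /grid_deriv mulrCA; congr (_ * _); rewrite mulr_sumr.
by apply: eq_bigr => r _; rewrite mulrCA.
Qed.

Lemma grid_derivN t a : grid_deriv t (fun r => - a r) = - grid_deriv t a.
Proof.
rewrite -mulN1r -grid_derivZ; apply: grid_deriv_ext => r.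
by rewrite mulN1r.
Qed.

Lemma grid_deriv_cst t c : grid_deriv t (fun=> c) = 0.
Proof.
rewrite /grid_deriv -mulr_suml.
have := w_moments (leq0n N); under eq_bigr do rewrite expr0 mulr1.
by move=> ->; rewrite mul0r mulr0.
Qed.

Lemma grid_derivB t a b :
  grid_deriv t (fun r => a r - b r) = grid_deriv t a - grid_deriv t b.
Proof. by rewrite grid_derivD grid_derivN. Qed.

Lemma grid_deriv_sum (J : Type) (s : seq J) t (a : J -> nat -> R) :
  grid_deriv t (fun r => \sum_(j <- s) a j r) = \sum_(j <- s) grid_deriv t (a j).
Proof.
elim: s => [|j s IHs].
  rewrite big_nil -[RHS](grid_deriv_cst t 0).
  by apply: grid_deriv_ext => r; rewrite big_nil.
rewrite big_cons -IHs -grid_derivD.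
by apply: grid_deriv_ext => r; rewrite big_cons.
Qed.

Lemma grid_deriv_eqO a b : (forall r, eqO h N.+1 (a ^~ r) (b ^~ r)) ->
  eqO h N (fun i => grid_deriv (h i) (a i)) (fun i => grid_deriv (h i) (b i)).
Proof.
move=> /(eqO_weighted (n := N.+1) w) ab.
by apply: bigO_ext (bigO_div h_gt0 ab) => i; rewrite mulrBr.
Qed.

Lemma grid_deriv_bpoly Q : bpoly h Q ->
  eqO h N (fun i => grid_deriv (h i) (fun r => (Q i).[r%:R * h i])) (fun i => (Q i)`_1).
Proof.
move=> /(bpoly_weighted h_gt0 h_le1 N.+1 N.+1 w) /(bigO_div h_gt0).
apply: bigO_ext => i; rewrite mulrBr; congr (_ - _).
under eq_bigr => k _ do rewrite w_moments -1?ltnS//.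
rewrite (bigD1 (Ordinal (N_gt0 : 1 < N.+1)%N))//= big1 => [|k k1].
  by rewrite mul1r addr0 expr1 mulrCA mulVf ?mulr1// gt_eqF.
by move: k1; rewrite -(inj_eq val_inj)/= => /negbTE->; rewrite mul0r.
Qed.

Lemma grid_deriv_expands a : expands h N.+1 a -> exists Q,
  [/\ bpoly h Q, forall r, eqO h N.+1 (a ^~ r) (fun i => (Q i).[r%:R * h i])
    & eqO h N (fun i => grid_deriv (h i) (a i)) (fun i => (Q i)`_1)].
Proof.
move=> /expands_poly[Q Q0 aQ]; exists Q; split=> //.
by apply: eqO_trans (grid_deriv_bpoly Q0); exact: grid_deriv_eqO.
Qed.

Lemma grid_deriv_bounded a :
  expands h N.+1 a -> bigO h 0 (fun i => grid_deriv (h i) (a i)).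
Proof.
move=> /grid_deriv_expands[Q [Q0 _ aQ]].
by apply: eqO_bigO (bigO_bounded h_gt0 h_le1 aQ) _; exact: Q0.2.
Qed.

(** Up to O(h^N), the functional reads off the linear coefficient, and the
    linear coefficient of a product obeys the Leibniz rule. *)
Lemma grid_derivM a b : expands h N.+1 a -> expands h N.+1 b ->
  eqO h N (fun i => grid_deriv (h i) (fun r => a i r * b i r))
    (fun i => a i 0%N * grid_deriv (h i) (b i) + b i 0%N * grid_deriv (h i) (a i)).
Proof.
move=> aX bX; have [P [P0 aP aP1]] := grid_deriv_expands aX.
have [Q [Q0 bQ bQ1]] := grid_deriv_expands bX.
have abPQ r : eqO h N.+1 (fun i => a i r * b i r)
    (fun i => (P i * Q i).[r%:R * h i]).
  apply: (eqO_trans (b := fun i => b i r * (P i).[r%:R * h i])).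
    apply: bigO_ext (eqO_mull (expands_bounded h_gt0 h_le1 r bX) (aP r)) => i.
    by rewrite mulrC.
  have P0r : bigO h 0 (fun i => (P i).[r%:R * h i]).
    apply: (exact_bounded h_gt0 h_le1 r (a := fun i r => (P i).[r%:R * h i])).
    by exists P.
  apply: bigO_ext (eqO_mull P0r (bQ r)) => i.
  by rewrite hornerM mulrC.
have at0 a' Q' : eqO h N.+1 (a' ^~ 0%N) (fun i => (Q' i).[0%:R * h i]) ->
    eqO h N (a' ^~ 0%N) (fun i => (Q' i)`_0).
  move=> /(bigO_weaken h_gt0 h_le1 (leqnSn N)); apply: bigO_ext => i.
  by rewrite mul0r horner_coef0.
apply: eqO_trans (grid_deriv_eqO (a := fun i r => a i r * b i r)
  (b := fun i r => (P i * Q i).[r%:R * h i]) abPQ) _.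
apply: eqO_trans (grid_deriv_bpoly (bpolyM P0 Q0)) _.
apply: (eqO_trans (b := fun i => (P i)`_0 * (Q i)`_1 + (Q i)`_0 * (P i)`_1)).
  by apply: eqO_eq => i; rewrite coefM !big_ord_recl big_ord0/= addr0 [(Q i)`_0 * _]mulrC.
apply: eqO_sym; apply: eqO_add.
  apply: (eqO_trans (b := fun i => a i 0%N * (Q i)`_1)).
    by apply: eqO_mull => //; exact: (expands_bounded h_gt0 h_le1 0 aX).
  apply: bigO_ext (eqO_mull (Q0.2 1%N) (at0 _ _ (aP 0%N))) => i.
  by rewrite ![_ * (Q i)`_1]mulrC.
apply: (eqO_trans (b := fun i => b i 0%N * (P i)`_1)).
  by apply: eqO_mull => //; exact: (expands_bounded h_gt0 h_le1 0 bX).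
apply: bigO_ext (eqO_mull (P0.2 1%N) (at0 _ _ (bQ 0%N))) => i.
by rewrite ![_ * (P i)`_1]mulrC.
Qed.

Lemma dterm0 k f (a : V) : dterm k.+1 f a 0 = 0.
Proof. by rewrite /= big1// => j _; rewrite mxE mul0r. Qed.

(** Expand f at the first node: the constant term is annihilated, the linear
    term gives the chain rule, and the Leibniz rule kills every term with two
    or more increments because increments vanish at that node. *)
Lemma grid_deriv_comp (f : V -> R) (x : I -> nat -> V) (rho : R) :
  smooth f -> (forall i r, box rho (x i r)) ->
  (forall j, expands h N.+1 (fun i r => x i r j 0)) ->
  eqO h N (fun i => grid_deriv (h i) (fun r => f (x i r)))
    (fun i => \sum_(j < 3) partial j f (x i 0%N) *
      grid_deriv (h i) (fun r => x i r j 0)).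
Proof.
move=> fC xB xX.
pose d i r := x i r - x i 0%N.
have dX j : expands h N.+1 (fun i r => d i r j 0).
  apply: (@expands_ext _ _ _ _ _ (fun i r => x i r j 0 - x i 0%N j 0)).
    by move=> i r; rewrite !mxE.
  apply: expands_sub => //; apply: expands_cst => //.
  exact: (expands_bounded h_gt0 h_le1 0 (xX j)).
pose T k i r := dterm k f (x i 0%N) (d i r).
apply: eqO_trans (grid_deriv_eqO (a := fun i r => f (x i r))
  (b := fun i r => \sum_(k < N.+1) T k i r / k`!%:R)
  (eqO_taylor (fC _) xB xX)) _.
apply: (eqO_trans (b := fun i => \sum_(k < N.+1) k`!%:R^-1 *
    grid_deriv (h i) (T k i))).
  apply: eqO_eq => i; rewrite grid_deriv_sum; apply: eq_bigr => k _.
  by rewrite -grid_derivZ; apply: grid_deriv_ext => r; rewrite mulrC.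
have T0 i : grid_deriv (h i) (T 0%N i) = 0 by exact: grid_deriv_cst.
have T1 i : grid_deriv (h i) (T 1%N i) = \sum_(j < 3) partial j f (x i 0%N) *
      grid_deriv (h i) (fun r => x i r j 0).
  rewrite /T/= grid_deriv_sum; apply: eq_bigr => j _.
  rewrite -grid_derivZ.
  transitivity (grid_deriv (h i) (fun r => partial j f (x i 0%N) * x i r j 0 -
      partial j f (x i 0%N) * x i 0%N j 0)).
    by apply: grid_deriv_ext => r; rewrite !mxE mulrC mulrBr.
  by rewrite grid_derivB grid_deriv_cst subr0.
have T2 k : eqO h N (fun i => grid_deriv (h i) (T k.+2 i)) (fun=> 0).
  have Tj j : eqO h N (fun i => grid_deriv (h i)
      (fun r => d i r j 0 * dterm k.+1 (partial j f) (x i 0%N) (d i r))) (fun=> 0).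
    apply: eqO_trans (grid_derivM (dX j) _) _.
      by apply: (expands_dterm _ (fun i => xB i 0%N) dX); exact: (fC k.+2).2.
    apply: eqO_eq => i; have -> : d i 0%N = 0 by rewrite /d subrr.
    by rewrite dterm0 mxE !mul0r addr0.
  apply: (eqO_trans (b := fun i => \sum_(j < 3) grid_deriv (h i)
      (fun r => d i r j 0 * dterm k.+1 (partial j f) (x i 0%N) (d i r)))).
    by apply: eqO_eq => i; rewrite -grid_deriv_sum.
  apply: (@bigO_ext _ _ _ _ _ (fun i => \sum_(j < 3) (grid_deriv (h i)
      (fun r => d i r j 0 * dterm k.+1 (partial j f) (x i 0%N) (d i r)) - 0))).
    by move=> i; rewrite subr0; apply: eq_bigr => j _; rewrite subr0.
  by apply: bigO_sum => j _; exact: Tj.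
case: N N_gt0 T2 => // n _ T2.
apply: (eqO_trans (b := fun i => \sum_(j < 3) partial j f (x i 0%N) *
      grid_deriv (h i) (fun r => x i r j 0) + 0)); last first.
  by apply: eqO_eq => i; rewrite addr0.
apply: (@bigO_ext _ _ _ _ _ (fun i => \sum_(k < n)
   (k.+2)`!%:R^-1 * (grid_deriv (h i) (T k.+2 i) - 0))).
  move=> i; rewrite 2!big_ord_recl/= T0 T1 mulr0 add0r invr1 mul1r.
  rewrite addr0 addrAC subrr add0r; apply: eq_bigr => k _.
  by rewrite subr0.
apply: bigO_sum => k _; apply: bigO_scale; exact: T2.
Qed.

End GridDerivative.
(** * Smooth fields *)

Section SmoothFields.
Variable R : realType.
Local Notation V := 'cV[R]_3.
Implicit Types f g : V -> R.

Lemma Ck_cst k (c : R) : Ck k (fun _ : V => c).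
Proof.
elim: k c => [|k IHk] c /=; first by move=> x; exact: cst_continuous.
split=> [x|i]; first exact: differentiable_cst.
have -> : partial i (fun _ : V => c) = fun=> 0.
  by apply/funext => x; exact: derive_cst.
exact: IHk.
Qed.

Lemma Ck_add k f g : Ck k f -> Ck k g -> Ck k (fun x => f x + g x).
Proof.
elim: k f g => [|k IHk] f g /=; first by move=> fc gc x; exact: cvgD (fc x) (gc x).
move=> [fd fC] [gd gC]; split=> [x|i]; first exact: differentiableD.
have -> : partial i (fun x => f x + g x) =
    fun x => partial i f x + partial i g x.
  by apply/funext => x; apply: deriveD; exact: diff_derivable.
exact: IHk.
Qed.

Lemma Ck_scale k (c : R) f : Ck k f -> Ck k (fun x => c * f x).
Proof.
elim: k f => [|k IHk] f /=.
  by move=> fc x; exact: cvgM (cvg_cst c) (fc x).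
move=> [fd fC]; split=> [x|i]; first exact: differentiableZ.
have -> : partial i (fun x => c * f x) = fun x => c * partial i f x.
  by apply/funext => x; apply: deriveZ; exact: diff_derivable.
exact: IHk.
Qed.

Lemma Ck_coord k j : Ck k (fun x : V => x j 0).
Proof.
case: k => [|k] /=; first exact: coord_continuous.
split=> [x|i]; first exact: differentiable_coord.
have -> : partial i (fun x : V => x j 0) = fun=> axis R i j 0.
  apply/funext => x; have := @derive_mx R V 3 1 id x (axis R i) (@derivable_id _ _ _ _).
  by rewrite derive_id => /matrixP/(_ j 0); rewrite !mxE.
exact: Ck_cst.
Qed.

Lemma Ck_component k (G : V -> V) j : Ck k G -> Ck k (fun x => G x j 0).
Proof.
elim: k G => [|k IHk] G /=.
  move=> Gc x; apply: (@continuous_comp _ _ _ G (fun y : V => y j 0)).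
    exact: Gc.
  exact: (@coord_continuous R 3 1 j 0 (G x)).
move=> [Gd GC]; split=> [x|i].
  apply: (@differentiable_comp _ _ _ _ G (fun y : V => y j 0)) => //.
  exact: differentiable_coord.
have -> : partial i (fun x => G x j 0) = fun x => partial i G x j 0.
  apply/funext => x; rewrite /partial derive_mx ?mxE//.
  exact: diff_derivable.
exact: IHk.
Qed.

Lemma smooth_component (G : V -> V) j : smooth G -> smooth (fun x => G x j 0).
Proof. by move=> GC k; exact: Ck_component. Qed.

Lemma smooth_full_potential (B0 : V) A1 j :
  smooth A1 -> smooth (fun x => full_potential B0 A1 x j 0).
Proof.
move=> AC k.
have -> : (fun x => full_potential B0 A1 x j 0) = fun x =>
    - 2^-1 * B0 (j + 2%:R) 0 * x (j + 1) 0
    + (2^-1 * B0 (j + 1) 0 * x (j + 2%:R) 0 + A1 x j 0).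
  by apply/funext => x; rewrite !mxE; ring.
apply: Ck_add; first by apply: Ck_scale; exact: Ck_coord.
apply: Ck_add; first by apply: Ck_scale; exact: Ck_coord.
exact: smooth_component.
Qed.

Lemma smooth_partial f i : smooth f -> smooth (partial i f).
Proof. by move=> fC k; exact: (fC k.+1).2. Qed.

(** A potential is one order smoother than its force. *)
Lemma smooth_of_grad (F : V -> V) (U : V -> R) :
  (forall x, differentiable U x) -> (forall x, F x = - grad U x) ->
  smooth F -> smooth U.
Proof.
move=> Ud FU FC.
have UC k : Ck k.+1 U.
  split=> // i; have -> : partial i U = fun x => (-1) * F x i 0.
    by apply/funext => x; rewrite FU !mxE mulN1r opprK.
  by apply: Ck_scale; exact: smooth_component.
by move=> k; apply: Ck_le (UC k).
Qed.

End SmoothFields.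

(** * The filters *)

Section FilterBounds.
Variable R : realType.
Implicit Types z h : R.

Lemma sin_le_id z : 0 <= z -> sin z <= z.
Proof.
rewrite le_eqVlt => /predU1P[<-|z0]; first by rewrite sin0.
have [c _] := @MVT R sin cos 0 z z0 (fun x _ => is_derive_sin x)
  (continuous_subspaceT (@continuous_sin R)).
rewrite sin0 !subr0 => ->; rewrite ler_piMl ?cos_le1//; exact: ltW.
Qed.

Lemma cos_ge_quadratic z : 0 <= z -> 1 - z ^+ 2 <= cos z.
Proof.
rewrite le_eqVlt => /predU1P[<-|z0]; first by rewrite cos0 expr0n subr0.
have [c] := @MVT R cos (fun x => - sin x) 0 z z0 (fun x _ => is_derive_cos x)
  (continuous_subspaceT (@continuous_cos R)).
rewrite in_itv/= cos0 subr0 => /andP[c0 cz] /eqP; rewrite subr_eq => /eqP ->.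
have : sin c <= z by rewrite (le_trans (sin_le_id (ltW c0)))// ltW.
by nra.
Qed.

Lemma sin_ge_cubic z : 0 <= z -> z - z ^+ 3 <= sin z.
Proof.
rewrite le_eqVlt => /predU1P[<-|z0]; first by rewrite sin0 expr0n subr0.
have [c] := @MVT R sin cos 0 z z0 (fun x _ => is_derive_sin x)
  (continuous_subspaceT (@continuous_sin R)).
rewrite in_itv/= sin0 !subr0 => /andP[c0 cz] ->.
have := cos_ge_quadratic (ltW c0).
rewrite -(ler_pM2r z0); apply: le_trans.
have -> : z - z ^+ 3 = (1 - z ^+ 2) * z by ring.
rewrite ler_wpM2r ?(ltW z0)// lerD2l lerN2 ler_pXn2r// ?nnegrE; exact: ltW.
Qed.

(** The bounds z - z^3 <= sin z <= z and cos z >= 1 - z^2 put every filter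
    coefficient within O(h^2) of 1. *)
Lemma filter_bounds h : 0 < h -> h <= 1 ->
  [/\ tanc (h / 2) != 0, `|1 - tanc (h / 2)| <= h ^+ 2,
      `|1 - (tanc (h / 2))^-1| <= h ^+ 2 & `|1 - (sinc (h / 2))^-1| <= h ^+ 2].
Proof.
move=> h0 h1; pose z := h / 2; rewrite -/z.
have z0 : 0 < z by rewrite divr_gt0.
have z12 : z <= 2^-1 by rewrite /z -[leRHS]mul1r ler_wpM2r.
have s1 := sin_le_id (ltW z0); have s2 := sin_ge_cubic (ltW z0).
have c1 := cos_ge_quadratic (ltW z0); have c2 := cos_le1 z.
have hz : h = 2 * z by rewrite /z; field.
have z2 : z ^+ 2 <= 4^-1 by nra.
have c0 : 3 / 4 <= cos z by lra.
have s0 : 3 / 4 * z <= sin z.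
  have -> : 3 / 4 * z = z - 4^-1 * z by field.
  by apply: le_trans s2; rewrite lerD2l lerN2 exprSr ler_wpM2r// ltW.
have sgt0 : 0 < sin z by lra.
have cgt0 : 0 < cos z by lra.
have zn0 : z != 0 by rewrite gt_eqF.
have sn0 : sin z != 0 by rewrite gt_eqF.
have cn0 : cos z != 0 by rewrite gt_eqF.
have diff : `|sin z - z * cos z| <= z ^+ 3.
  by rewrite ler_norml; apply/andP; split; nra.
have diff' : `|sin z - z| <= z ^+ 3 by rewrite ler_norml; apply/andP; split; nra.
have quot a b : `|a| <= z ^+ 3 -> 3 / 4 * z <= b -> `|a / b| <= h ^+ 2.
  move=> az bz; have b0 : 0 < b by lra.
  rewrite normrM normfV (gtr0_norm b0) ler_pdivrMr//.
  apply: le_trans az _; rewrite hz; have zz : 0 < z ^+ 2 by rewrite exprn_gt0.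
  have -> : z ^+ 3 = z ^+ 2 * z by ring.
  by nra.
rewrite /tanc /sinc /tan; split.
- by rewrite !mulf_neq0 ?invr_eq0.
- have -> : 1 - sin z / cos z / z = - ((sin z - z * cos z) / (z * cos z)).
    by field; rewrite zn0 cn0.
  by rewrite normrN; apply: quot => //; nra.
- have -> : 1 - (sin z / cos z / z)^-1 = (sin z - z * cos z) / sin z.
    by field; rewrite zn0 cn0 sn0.
  exact: quot.
- have -> : 1 - (sin z / z)^-1 = (sin z - z) / sin z.
    by field; rewrite zn0 sn0.
  exact: quot.
Qed.

Local Notation V := 'cV[R]_3.
Implicit Type b : V.

Lemma enorm_sq b : enorm b ^+ 2 = \sum_(i < 3) b i 0 ^+ 2.
Proof. by rewrite sqr_sqrtr// sumr_ge0// => i _; exact: sqr_ge0. Qed.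

(** The double cross product with a unit vector is minus the projection onto
    its orthogonal plane. *)
Lemma skewmx_sq b : enorm b = 1 ->
  Defs.skewmx b *m Defs.skewmx b = b *m b^T - 1%:M.
Proof.
move=> b1; have {b1} : \sum_(i < 3) b i 0 ^+ 2 = 1.
  by rewrite -enorm_sq b1 expr1n.
have [e0 e1 e2] : [/\ ord0 = 0 :> 'I_3, lift ord0 ord0 = 1 :> 'I_3
    & lift ord0 (lift ord0 ord0) = 2%:R :> 'I_3] by split; exact: val_inj.
rewrite !big_ord_recl big_ord0 addr0 e0 e1 e2 => b1.
have E1 : 1 + 1 = 2%:R :> 'I_3 by exact: val_inj.
have E2 : 2%:R + 1 = 0 :> 'I_3 by exact: val_inj.
have E3 : 1 + 2%:R = 0 :> 'I_3 by exact: val_inj.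
have E4 : 2%:R + 2%:R = 1 :> 'I_3 by exact: val_inj.
have cases (P : 'I_3 -> Prop) : P 0 -> P 1 -> P 2%:R -> forall i, P i.
  move=> P0 P1 P2 [[|[|[|//]]] Hi].
  - by rewrite (_ : Ordinal _ = 0)//; exact: val_inj.
  - by rewrite (_ : Ordinal _ = 1)//; exact: val_inj.
  - by rewrite (_ : Ordinal _ = 2%:R)//; exact: val_inj.
apply/matrixP => i j; rewrite !mxE !big_ord_recl !big_ord0 e0 e1 e2 !mxE.
elim/cases: i; elim/cases: j;
  rewrite ?(E1, E2, E3, E4, add0r) /=; lra.
Qed.

Definition Psi_inv b h : 'M[R]_3 :=
  1%:M + (1 - (tanc (h / 2))^-1) *: (Defs.skewmx b *m Defs.skewmx b).

Lemma trmx_Psi_inv b h : enorm b = 1 -> (Psi_inv b h)^T = Psi_inv b h.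
Proof.
move=> b1; rewrite /Psi_inv skewmx_sq//.
by rewrite linearD/= linearZ/= linearB/= trmx_mul trmxK trmx1.
Qed.

(** With P the square of the skew matrix of a unit vector, P^2 = -P, so
    (1 + s P)(1 + t P) = 1 + (s + t - s t) P = 1 when (1 - s)(1 - t) = 1. *)
Lemma Psi_invK b h : enorm b = 1 -> 0 < h -> h <= 1 ->
  Psi_inv b h *m Psi b h = 1%:M.
Proof.
move=> b1 h0 h1; have [t0 _ _ _] := filter_bounds h0 h1.
rewrite /Psi_inv /Psi; set P := Defs.skewmx b *m _.
have PP : P *m P = - P.
  have bb : b^T *m b = 1%:M.
    apply/matrixP => i j; rewrite !ord1 !mxE eqxx.
    by under eq_bigr do rewrite mxE -expr2; rewrite -enorm_sq b1 expr1n.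
  rewrite /P skewmx_sq// mulmxBl mul1mx mulmxBr mulmx1 -mulmxA.
  by rewrite [b^T *m _]mulmxA bb mul1mx subrr sub0r.
move: (tanc _) t0 P PP => t t0 P PP.
rewrite mulmxDl !mulmxDr !mul1mx mulmx1 -scalemxAl -scalemxAr PP.
by apply/matrixP => i j; rewrite !mxE; field.
Qed.

End FilterBounds.
(** * Smoothness of bounded numerical solutions *)

Definition velocity (R : realType) (t : R) (y : nat -> 'cV[R]_3) (r : nat) :=
  t^-1 *: (y r.+1 - y r).

Lemma velocity_step (R : realType) (B0 : 'cV[R]_3) A F (t : R) y r j :
  t != 0 -> FVI_step B0 A F t y r ->
  velocity t y r.+1 j 0 - velocity t y r j 0 = \sum_(k < 3) Psi B0 t j k *
    (2^-1 * \sum_(l < 3) Jac A (mid y r.+1) l k * (t * velocity t y r.+1 l 0)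
     + 2^-1 * \sum_(l < 3) Jac A (mid y r) l k * (t * velocity t y r l 0)
     - (A (mid y r.+1) k 0 - A (mid y r) k 0)
     + t / 2 * (F (mid y r.+1) k 0 + F (mid y r) k 0)).
Proof.
move=> t0 /colP/(_ j) E.
have vE s l : t * velocity t y s l 0 = (y s.+1 - y s) l 0.
  by rewrite mxE mulrA mulfV// mul1r.
apply: (mulfI t0); rewrite mulrBr !vE.
transitivity ((y r.+2 - 2 *: y r.+1 + y r) j 0).
  by rewrite !mxE; ring.
rewrite E mxE mulr_sumr; apply: eq_bigr => k _.
rewrite mulrCA; congr (_ * _).
have addE (a b : 'cV[R]_3) : (a + b) k 0 = a k 0 + b k 0 by rewrite mxE.
rewrite 3!addE.
have JE s : ((t / 2) *: ((Jac A (mid y s))^T *m (y s.+1 - y s))) k 0 =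
    t * (2^-1 * \sum_(l < 3) Jac A (mid y s) l k * (t * velocity t y s l 0)).
  rewrite 2!mxE mulrA; congr (_ * _); apply: eq_bigr => l _.
  by rewrite vE; congr (_ * _); rewrite mxE.
rewrite !JE; move: (\sum_(l < 3) _) (\sum_(l < 3) _) => S S'.
by rewrite !mxE; ring.
Qed.

Section BoundedSolutions.
Variables (R : realType) (I : Type) (h : I -> R).
Hypothesis h_gt0 : forall i, 0 < h i.
Hypothesis h_le1 : forall i, h i <= 1.
Local Notation V := 'cV[R]_3.
Variables (B0 : V) (A F : V -> V).
Hypothesis A_smooth : forall j, smooth (fun x => A x j 0).
Hypothesis F_smooth : forall j, smooth (fun x => F x j 0).
Variables (y : I -> nat -> V) (rho : R).
Hypothesis y_box : forall i r, box rho (y i r).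
Local Notation v := (fun i => velocity (h i) (y i)).

Lemma mid_box i r : box rho (mid (y i) r).
Proof.
move=> j; rewrite !mxE normrM ger0_norm ?invr_ge0// ler_pdivrMl//.
by rewrite (le_trans (ler_normD _ _))// mulr2n mulrDl mul1r lerD//; exact: y_box.
Qed.

Lemma field_bounded (f : V -> R) (x : I -> V) (t : R) : smooth f ->
  (forall i, box t (x i)) -> bigO h 0 (fun i => f (x i)).
Proof.
move=> /(_ 0%N)/(continuous_box t)[C fC] xB.
by exists C => i; rewrite expr0 mulr1; exact: fC.
Qed.

Lemma filter_eqO (c : I -> R) j k : (forall i, `|c i| <= h i ^+ 2) ->
  eqO h 2 (fun i => (1%:M + c i *: (Defs.skewmx B0 *m Defs.skewmx B0)) j k)
    (fun=> (j == k)%:R).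
Proof.
move=> ch; exists `|(Defs.skewmx B0 *m Defs.skewmx B0) j k| => i.
by rewrite !mxE addrAC subrr add0r normrM mulrC ler_wpM2l.
Qed.

Lemma Psi_bounded j k : bigO h 0 (fun i => Psi B0 (h i) j k).
Proof.
apply: eqO_bigO (bigO_cst h (j == k)%:R); apply: (@bigO_weaken _ _ _ _ _ 0 2) => //.
by apply: filter_eqO => i; case: (filter_bounds (h_gt0 i) (h_le1 i)).
Qed.

Lemma Psi_inv_eqO j k :
  eqO h 2 (fun i => Psi_inv B0 (h i) j k) (fun=> (j == k)%:R).
Proof. by apply: filter_eqO => i; case: (filter_bounds (h_gt0 i) (h_le1 i)). Qed.

Lemma Phi_eqO j k : eqO h 2 (fun i => Phi B0 (h i) j k) (fun=> (j == k)%:R).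
Proof. by apply: filter_eqO => i; case: (filter_bounds (h_gt0 i) (h_le1 i)). Qed.

Lemma Psi_inv_bounded j k : bigO h 0 (fun i => Psi_inv B0 (h i) j k).
Proof.
apply: eqO_bigO (bigO_cst h (j == k)%:R); apply: (@bigO_weaken _ _ _ _ _ 0 2) => //.
exact: Psi_inv_eqO.
Qed.

Lemma Jac_smooth l k : smooth (fun x => Jac A x l k).
Proof.
have -> : (fun x => Jac A x l k) = partial k (fun x => A x l 0).
  by apply/funext => x; rewrite mxE.
exact: smooth_partial.
Qed.

Hypothesis y_step : forall i r, FVI_step B0 A F (h i) (y i) r.

(** The increments of the positions are bounded together with the positions,
    so the two-step relation bounds the increments of the velocities whatever
    the velocities are. *)
Lemma velocity_increment_bounded r j :
  bigO h 0 (fun i => v i r.+1 j 0 - v i r j 0).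
Proof.
have inc s l : bigO h 0 (fun i => h i * v i s l 0).
  apply: (@bigO_ext _ _ _ _ _ (fun i => y i s.+1 l 0 - y i s l 0)).
    by move=> i; rewrite !mxE mulVKf// gt_eqF.
  by apply: bigO_sub; exists rho => i; rewrite expr0 mulr1; exact: y_box.
have mB s i : box rho (mid (y i) s) by exact: mid_box.
have JB s l k : bigO h 0 (fun i => Jac A (mid (y i) s) l k).
  exact: field_bounded (Jac_smooth l k) (mB s).
apply: bigO_ext.
  move=> i; apply: velocity_step (y_step i r); exact: lt0r_neq0.
apply: bigO_sum => k _; apply: bigO_mull; first exact: Psi_bounded.
have sumB s : bigO h 0 (fun i => 2^-1 *
    \sum_(l < 3) Jac A (mid (y i) s) l k * (h i * v i s l 0)).
  apply: bigO_scale; apply: bigO_sum => l _.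
  by apply: bigO_mull; [exact: JB|exact: inc].
apply: bigO_add; first apply: bigO_sub; first by apply: bigO_add; exact: sumB.
  by apply: bigO_sub; exact: field_bounded (A_smooth k) (mB _).
apply: bigO_mull.
  apply: bigO_mulr; first exact: bigO_bounded_step.
  exact: bigO_cst.
by apply: bigO_add; exact: field_bounded (F_smooth k) (mB _).
Qed.

Hypothesis v0_bounded : forall j, bigO h 0 (fun i => v i 0%N j 0).

Lemma velocity_bounded r j : bigO h 0 (fun i => v i r j 0).
Proof.
elim: r => [|r IHr]; first exact: v0_bounded.
apply: bigO_ext (bigO_add IHr (velocity_increment_bounded r j)) => i.
by rewrite addrC subrK.
Qed.

Lemma position_increment i r j : y i r.+1 j 0 - y i r j 0 = h i * v i r j 0.
Proof. by rewrite !mxE mulVKf// gt_eqF. Qed.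

Lemma position0_bounded j : bigO h 0 (fun i => y i 0%N j 0).
Proof. by exists rho => i; rewrite expr0 mulr1; exact: y_box. Qed.

Lemma mid_expands m : (forall j, expands h m (fun i r => y i r j 0)) ->
  forall j, expands h m (fun i r => mid (y i) r j 0).
Proof.
move=> yX j.
apply: expands_ext (expands_scale h_gt0 h_le1 2^-1
  (expands_add (yX j) (expands_shift h_gt0 h_le1 (yX j)))) => i r.
by rewrite !mxE.
Qed.

(** Bootstrap: an expansion of the positions to order m gives the right-hand
    side of the two-step relation to order m - 1, since a difference quotient
    loses one order, and summing twice gives the positions to order m + 1. *)
Lemma solution_expands m :
  (forall j, expands h m (fun i r => y i r j 0)) /\
  (forall j, expands h m (fun i r => v i r j 0)).
Proof.
suff H : (forall j, expands h m.+1 (fun i r => y i r j 0)) /\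
    (forall j, expands h m (fun i r => v i r j 0)).
  split=> [j|]; last exact: H.2.
  by apply: (expands_weaken h_gt0 h_le1 (leqnSn m)); exact: H.1.
have integrate n : (forall j, expands h n (fun i r => v i r j 0)) ->
    forall j, expands h n.+1 (fun i r => y i r j 0).
  move=> vX j; apply: (expands_antidifference h_gt0 h_le1 _ (vX j)).
    exact: position0_bounded.
  by move=> i r; exact: position_increment.
elim: m => [|m [yX vX]].
  have v0X j : expands h 0 (fun i r => v i r j 0).
    by apply: expands0 => // r; exact: velocity_bounded.
  by split=> //; exact: integrate.
suff vX' j : expands h m.+1 (fun i r => v i r j 0) by split=> //; exact: integrate.
have mX := mid_expands yX.
have lower := expands_weaken h_gt0 h_le1 (leqnSn m).
pose G k i r :=
  2^-1 * \sum_(l < 3) Jac A (mid (y i) r.+1) l k * v i r.+1 l 0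
  + 2^-1 * \sum_(l < 3) Jac A (mid (y i) r) l k * v i r l 0
  - (h i)^-1 * (A (mid (y i) r.+1) k 0 - A (mid (y i) r) k 0)
  + 2^-1 * (F (mid (y i) r.+1) k 0 + F (mid (y i) r) k 0).
apply: (expands_antidifference h_gt0 h_le1 (b := fun i r =>
    \sum_(k < 3) Psi B0 (h i) j k * G k i r)).
- exact: v0_bounded.
- apply: expands_sum => // k; apply: expands_mulc => //; first exact: Psi_bounded.
  have JX : expands h m
      (fun i r => 2^-1 * \sum_(l < 3) Jac A (mid (y i) r) l k * v i r l 0).
    apply: expands_scale => //; apply: expands_sum => // l.
    apply: expands_mul => //; apply: lower.
    exact: (expands_comp h_gt0 h_le1 (Jac_smooth l k) mid_box mX).
  have FX := expands_comp h_gt0 h_le1 (F_smooth k) mid_box mX.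
  have AX := expands_comp h_gt0 h_le1 (A_smooth k) mid_box mX.
  apply: expands_add => //; first apply: expands_sub => //.
  + apply: expands_add => //; exact: (expands_shift h_gt0 h_le1 JX).
  + exact: expands_quotient.
  + apply: expands_scale => //; apply: expands_add => //; last exact: lower.
    by apply: lower; exact: (expands_shift h_gt0 h_le1 FX).
- move=> i r; rewrite (velocity_step _ (lt0r_neq0 (h_gt0 i)) (y_step i r)).
  rewrite mulr_sumr; apply: eq_bigr => k _; rewrite mulrCA; congr (_ * _).
  rewrite /G; have hn := lt0r_neq0 (h_gt0 i).
  have pull s : \sum_(l < 3) Jac A (mid (y i) s) l k * (h i * v i s l 0) =
      h i * \sum_(l < 3) Jac A (mid (y i) s) l k * v i s l 0.
    by rewrite mulr_sumr; apply: eq_bigr => l _; rewrite mulrCA.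
  rewrite !pull; move: (\sum_(l < 3) _) (\sum_(l < 3) _) => S T.
  by field.
Qed.

End BoundedSolutions.
(** * The modified energy *)

Section ModifiedEnergy.
Variable R : realType.
Local Notation V := 'cV[R]_3.

Definition dot (u v : V) : R := \sum_(j < 3) u j 0 * v j 0.

Lemma dotDl u u' v : dot (u + u') v = dot u v + dot u' v.
Proof. by rewrite -big_split; apply: eq_bigr => j _; rewrite mxE mulrDl. Qed.

Lemma dotBl u u' v : dot (u - u') v = dot u v - dot u' v.
Proof. by rewrite -sumrB; apply: eq_bigr => j _; rewrite !mxE mulrBl. Qed.

Lemma dotC u v : dot u v = dot v u.
Proof. by apply: eq_bigr => j _; rewrite mulrC. Qed.

Lemma enorm_dot u : enorm u ^+ 2 = dot u u.
Proof. by rewrite enorm_sq; apply: eq_bigr => j _; rewrite expr2. Qed.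

Variables (B0 : V) (A F : V -> V) (U : V -> R) (N : nat) (w : nat -> R).
Implicit Types (t : R) (y : nat -> V).

(** Times t, this is the discrete Lagrangian whose Euler-Lagrange equations are
    the two-step relation; the inverse filter acts as the mass matrix. *)
Definition lagrangian t y r : R :=
  2^-1 * dot (velocity t y r) (Psi_inv B0 t *m velocity t y r)
  + dot (A (mid y r)) (velocity t y r) - U (mid y r).

Definition mean_momentum t y r : V :=
  Psi_inv B0 t *m velocity t y r + A (mid y r).

(** The impulse over half a grid interval: the momentum changes by this amount
    between the midpoint of the interval and either of its ends. *)
Definition half_impulse t y r : V :=
  (t / 2) *: ((Jac A (mid y r))^T *m velocity t y r + F (mid y r)).

Definition left_momentum t y r := mean_momentum t y r - half_impulse t y r.
Definition right_momentum t y r := mean_momentum t y r + half_impulse t y r.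

(** The two-step relation is the discrete Euler-Lagrange equation: the momentum
    leaving one grid interval enters the next one. *)
Lemma momentum_matching t y r :
  Psi_inv B0 t *m Psi B0 t = 1%:M -> t != 0 -> FVI_step B0 A F t y r ->
  left_momentum t y r.+1 = right_momentum t y r.
Proof.
move=> PsiK t0 E.
have yE s : y s.+1 - y s = t *: velocity t y s.
  by rewrite scalerA mulfV// scale1r.
have /(congr1 (mulmx (Psi_inv B0 t))) : t *: (velocity t y r.+1 - velocity t y r) =
    y r.+2 - 2 *: y r.+1 + y r.
  by rewrite scalerBr -!yE; apply/colP => k; rewrite !mxE; ring.
rewrite E mulmxA PsiK mul1mx !yE.
rewrite /left_momentum /right_momentum /mean_momentum /half_impulse.
move: (velocity t y r.+1) (velocity t y r) => v1 v0.
rewrite -!scalemxAr mulmxBr => E'.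
apply: (scalerI t0); apply/eqP; rewrite -subr_eq0; apply/eqP.
move: E'; move: (Psi_inv B0 t *m v1) (Psi_inv B0 t *m v0) => P1 P0.
move: ((Jac A _)^T *m v1) ((Jac A _)^T *m v0) => J1 J0 /colP E'.
apply/colP => k; have := E' k; rewrite !mxE => Ek.
rewrite (_ : P1 k 0 = t^-1 * (t * (P1 k 0 - P0 k 0)) + P0 k 0); last by field.
by rewrite Ek; field.
Qed.

Definition slope t y : V := \col_j grid_deriv N w t (fun r => y r j 0).

(** Abel summation of the weights, which turns the derivative of a sequence
    into the increment of a weighted sum of its values. *)
Definition tail_weight s : R := \sum_(r < N.+1 | (s < r)%N) w r.

(** Momentum times velocity minus Lagrangian, with the velocity replaced by the
    grid derivative and the Lagrangian by the weighted sum whose increment is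
    its grid derivative: the Noether charge of translations in time. *)
Definition modified_energy t y : R :=
  dot (left_momentum t y 0) (slope t y)
  - \sum_(s < N) tail_weight s * lagrangian t y s.

Lemma tail_weight_sum (l : nat -> R) :
  \sum_(s < N) tail_weight s * (l s.+1 - l s) =
  \sum_(r < N.+1) w r * (l r - l 0%N).
Proof.
transitivity (\sum_(s < N) \sum_(r < N.+1)
    if (s < r)%N then w r * (l s.+1 - l s) else 0).
  by apply: eq_bigr => s _; rewrite mulr_suml big_mkcond.
rewrite exchange_big; apply: eq_bigr => r _.
rewrite -big_mkcond -mulr_sumr; congr (_ * _).
rewrite -(big_ord_widen N (fun s => l s.+1 - l s)) -1?ltnS//.
by rewrite -(big_mkord xpredT (fun s => l s.+1 - l s)) telescope_sumr.
Qed.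

Lemma lagrangian_algebra t (W J : 'M[R]_3) (v Av Fv a a' : V) :
  t != 0 -> W^T = W ->
  2^-1 * (\sum_(j < 3) (v j 0 * (\sum_(k < 3) W j k * (t^-1 * (a' k 0 - a k 0)))
      + (\sum_(k < 3) W j k * v k 0) * (t^-1 * (a' j 0 - a j 0))))
  + \sum_(j < 3) (Av j 0 * (t^-1 * (a' j 0 - a j 0))
      + v j 0 * (\sum_(k < 3) J j k * (2^-1 * (a k 0 + a' k 0))))
  + \sum_(k < 3) Fv k 0 * (2^-1 * (a k 0 + a' k 0))
  = t^-1 * (dot (W *m v + Av + (t / 2) *: (J^T *m v + Fv)) a'
            - dot (W *m v + Av - (t / 2) *: (J^T *m v + Fv)) a).
Proof.
move=> t0 /matrixP Wsym.
have W10 := Wsym (lift ord0 ord0) ord0.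
have W20 := Wsym (lift ord0 (lift ord0 ord0)) ord0.
have W21 := Wsym (lift ord0 (lift ord0 ord0)) (lift ord0 ord0).
rewrite !mxE in W10 W20 W21.
rewrite /dot !big_ord_recl !big_ord0 !mxE !big_ord_recl !big_ord0 !mxE -W10 -W20 -W21.
by field.
Qed.

End ModifiedEnergy.

Section EnergyEstimates.
Variables (R : realType) (I : Type) (h : I -> R).
Hypothesis h_gt0 : forall i, 0 < h i.
Hypothesis h_le1 : forall i, h i <= 1.
Local Notation V := 'cV[R]_3.
Variables (B0 : V) (A F : V -> V) (U : V -> R).
Hypothesis B0_unit : enorm B0 = 1.
Hypothesis A_smooth : forall j, smooth (fun x => A x j 0).
Hypothesis F_smooth : forall j, smooth (fun x => F x j 0).
Hypothesis U_smooth : smooth U.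
Hypothesis F_grad : forall x, F x = - grad U x.
Variables (y : I -> nat -> V) (rho : R).
Hypothesis y_box : forall i r, box rho (y i r).
Hypothesis y_step : forall i r, FVI_step B0 A F (h i) (y i) r.
Local Notation v := (fun i => velocity (h i) (y i)).
Hypothesis v0_bounded : forall j, bigO h 0 (fun i => v i 0%N j 0).
Variables (N : nat) (w : nat -> R).
Hypothesis N_gt1 : (1 < N)%N.
Hypothesis w_moments :
  forall k, (k <= N)%N -> \sum_(r < N.+1) w r * r%:R ^+ k = (k == 1)%:R.
Local Notation D i := (grid_deriv N w (h i)).
Local Notation W i := (Psi_inv B0 (h i)).
Local Notation shifted i := (fun r => y i r.+1).
Let N_gt0 : (0 < N)%N := ltnW N_gt1.

Let yX m j : expands h m (fun i r => y i r j 0).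
Proof.
by have [] :=
  solution_expands h_gt0 h_le1 A_smooth F_smooth y_box y_step v0_bounded m.
Qed.

Let vX m j : expands h m (fun i r => v i r j 0).
Proof.
by have [] :=
  solution_expands h_gt0 h_le1 A_smooth F_smooth y_box y_step v0_bounded m.
Qed.

Let mX m j : expands h m (fun i r => mid (y i) r j 0).
Proof. exact: mid_expands. Qed.

Let mB i r : box rho (mid (y i) r).
Proof. exact: mid_box. Qed.

Let AX m j : expands h m (fun i r => A (mid (y i) r) j 0).
Proof. exact: (expands_comp h_gt0 h_le1 (A_smooth j) mB (mX m)). Qed.

Let UX m : expands h m (fun i r => U (mid (y i) r)).
Proof. exact: (expands_comp h_gt0 h_le1 U_smooth mB (mX m)). Qed.

Let WvX m j : expands h m (fun i r => \sum_(k < 3) W i j k * v i r k 0).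
Proof.
by apply: expands_sum => // k; apply: expands_mulc => //; exact: Psi_inv_bounded.
Qed.

Lemma lagrangian_expands m :
  expands h m (fun i r => lagrangian B0 A U (h i) (y i) r).
Proof.
apply: expands_sub => //; apply: expands_add => //.
  apply: expands_scale => //; apply: expands_sum => // j.
  by apply: expands_mul => //; apply: expands_ext (WvX m j) => i r; rewrite mxE.
by apply: expands_sum => // j; exact: expands_mul.
Qed.

Lemma grid_deriv_velocity i j :
  D i (fun r => v i r j 0) =
  (h i)^-1 * (slope N w (h i) (shifted i) j 0 - slope N w (h i) (y i) j 0).
Proof.
rewrite !mxE -grid_derivB -grid_derivZ.
by apply: grid_deriv_ext => r; rewrite !mxE.
Qed.

Lemma grid_deriv_mid i j :
  D i (fun r => mid (y i) r j 0) =
  2^-1 * (slope N w (h i) (y i) j 0 + slope N w (h i) (shifted i) j 0).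
Proof.
rewrite !mxE -grid_derivD -grid_derivZ.
by apply: grid_deriv_ext => r; rewrite !mxE.
Qed.

(** The chain rule for the discrete Lagrangian, the discrete form of Noether's
    identity for translations in time. *)
Lemma lagrangian_deriv :
  eqO h N (fun i => D i (lagrangian B0 A U (h i) (y i)))
    (fun i => (h i)^-1 *
      (dot (right_momentum B0 A F (h i) (y i) 0) (slope N w (h i) (shifted i))
       - dot (left_momentum B0 A F (h i) (y i) 0) (slope N w (h i) (y i)))).
Proof.
pose dv i j := D i (fun r => v i r j 0).
pose dm i j := D i (fun r => mid (y i) r j 0).
pose kin i := 2^-1 * \sum_(j < 3) (v i 0%N j 0 * (\sum_(k < 3) W i j k * dv i k)
    + (\sum_(k < 3) W i j k * v i 0%N k 0) * dv i j).
pose mag i := \sum_(j < 3) (A (mid (y i) 0) j 0 * dv i j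
    + v i 0%N j 0 * \sum_(k < 3) Jac A (mid (y i) 0) j k * dm i k).
pose pot i := \sum_(k < 3) partial k U (mid (y i) 0) * dm i k.
apply: (eqO_trans (b := fun i => kin i + mag i - pot i)); last first.
  apply: eqO_eq => i.
  rewrite /right_momentum /left_momentum /mean_momentum /half_impulse.
  rewrite -lagrangian_algebra ?trmx_Psi_inv ?gt_eqF// /kin /mag /pot.
  rewrite -sumrN; congr (_ * _ + _ + _); apply: eq_bigr => j _.
  - by congr (_ * _ + _ * _);
      [apply: eq_bigr => k _; congr (_ * _)|]; exact: grid_deriv_velocity.
  - congr (_ * _ + _ * _); first exact: grid_deriv_velocity.
    by apply: eq_bigr => k _; congr (_ * _); exact: grid_deriv_mid.
  - rewrite F_grad -mulNr; congr (_ * _); first by rewrite !mxE.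
    exact: grid_deriv_mid.
apply: (eqO_trans (b := fun i =>
    2^-1 * \sum_(j < 3) D i (fun r => v i r j 0 * \sum_(k < 3) W i j k * v i r k 0)
    + \sum_(j < 3) D i (fun r => A (mid (y i) r) j 0 * v i r j 0)
    - D i (fun r => U (mid (y i) r)))).
  apply: eqO_eq => i; rewrite -!grid_deriv_sum// -grid_derivZ -grid_derivD -grid_derivB.
  apply: grid_deriv_ext => r; rewrite /lagrangian /dot.
  congr (_ * _ + _ - _); apply: eq_bigr => j _; congr (_ * _).
  by rewrite [LHS]mxE.
apply: eqO_add; first apply: eqO_add.
- apply: eqO_mull; first exact: bigO_cst.
  apply: eqO_sum => j _.
  apply: eqO_trans (grid_derivM h_gt0 h_le1 N_gt0 w_moments (vX _ j) (WvX _ j)) _.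
  apply: eqO_eq => i; congr (_ * _ + _); rewrite grid_deriv_sum//.
  by apply: eq_bigr => k _; rewrite grid_derivZ.
- apply: eqO_sum => j _.
  apply: eqO_trans (grid_derivM h_gt0 h_le1 N_gt0 w_moments (AX _ j) (vX _ j)) _.
  apply: eqO_add; first exact: eqO_refl.
  apply: eqO_mull; first exact: (expands_bounded h_gt0 h_le1 0 (vX 0 j)).
  apply: eqO_trans (grid_deriv_comp h_gt0 h_le1 N_gt0 w_moments (A_smooth j) mB (mX _)) _.
  by apply: eqO_eq => i; apply: eq_bigr => k _; rewrite mxE.
- apply: eqO_opp.
  exact: (grid_deriv_comp h_gt0 h_le1 N_gt0 w_moments U_smooth mB (mX _)).
Qed.

(** By momentum matching the kinetic parts combine into the right-hand side of
    Noether's identity, and by Abel summation the Lagrangian parts combine into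
    its left-hand side, so the drift is h times the defect of that identity. *)
Lemma modified_energy_drift :
  bigO h N.+1 (fun i => modified_energy B0 A F U N w (h i) (shifted i)
    - modified_energy B0 A F U N w (h i) (y i)).
Proof.
apply: bigO_ext (bigO_opp (bigO_mul (bigO_step h_gt0) lagrangian_deriv)) => i.
have hn := lt0r_neq0 (h_gt0 i).
have PsiK := Psi_invK B0_unit (h_gt0 i) (h_le1 i).
have match01 := momentum_matching PsiK hn (y_step i 0).
pose l r := lagrangian B0 A U (h i) (y i) r.
have tails : \sum_(s < N) tail_weight N w s * l s.+1 -
    \sum_(s < N) tail_weight N w s * l s = h i * D i l.
  rewrite mulVKf// -sumrB; under eq_bigr do rewrite -mulrBr.
  rewrite tail_weight_sum; under eq_bigr do rewrite mulrBr.
  rewrite sumrB -mulr_suml.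
  have := w_moments (leq0n N); under eq_bigr do rewrite expr0 mulr1.
  by move=> ->; rewrite mul0r subr0.
rewrite mulrBr -[h i * grid_deriv _ _ _ _]/(h i * D i l) -tails mulVKf// -match01.
rewrite /modified_energy.
rewrite -[\sum_(s < N) _ * lagrangian _ _ _ _ (shifted i) _]/(\sum_(s < N)
  tail_weight N w s * l s.+1).
rewrite -[left_momentum _ _ _ _ (shifted i) 0]/(left_momentum B0 A F (h i) (y i) 1).
rewrite -[\sum_(s < N) _ * lagrangian _ _ _ _ (y i) _]/(\sum_(s < N)
  tail_weight N w s * l s).
by ring.
Qed.

Lemma tail_weight_moments :
  \sum_(s < N) tail_weight N w s = 1 /\
  \sum_(s < N) tail_weight N w s * s%:R = - 2^-1.
Proof.
have w0 := w_moments (leq0n N).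
have w1 := w_moments N_gt0.
have w2 := w_moments N_gt1.
split.
  have := tail_weight_sum N w (fun r => r%:R).
  under eq_bigr do rewrite -natr1 addrAC subrr add0r mulr1.
  by move=> ->; rewrite -[RHS]w1; apply: eq_bigr => r _; rewrite subr0.
have := tail_weight_sum N w (fun r => (r%:R ^+ 2 - r%:R) / 2).
under eq_bigr => s _.
  rewrite (_ : (_ - _) / 2 - (_ - _) / 2 = s%:R); last by rewrite -natr1; field.
  over.
move=> ->; rewrite expr0n /= subr0 mul0r.
have -> : - 2^-1 = 2^-1 * (\sum_(r < N.+1) w r * r%:R ^+ 2 -
    \sum_(r < N.+1) w r * r%:R ^+ 1) :> R by rewrite w1 w2 /=; field.
rewrite -sumrB mulr_sumr; apply: eq_bigr => r _; rewrite subr0 expr1.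
by field.
Qed.

(** The tail weights have total mass 1 and mean -1/2. *)
Lemma lagrangian_tail :
  eqO h 2 (fun i => \sum_(s < N) tail_weight N w s * lagrangian B0 A U (h i) (y i) s)
    (fun i => lagrangian B0 A U (h i) (y i) 0
      - 2^-1 * (h i * D i (lagrangian B0 A U (h i) (y i)))).
Proof.
have [Q [Q0 lQ DQ]] :=
  grid_deriv_expands h_gt0 h_le1 N_gt0 w_moments (lagrangian_expands N.+1).
have lQ2 r : eqO h 2 (fun i => lagrangian B0 A U (h i) (y i) r)
    (fun i => (Q i).[r%:R * h i]).
  by apply: (bigO_weaken h_gt0 h_le1 _ (lQ r)); rewrite ltnW.
apply: eqO_trans (eqO_weighted (n := N) (tail_weight N w)
  (a := fun i => lagrangian B0 A U (h i) (y i))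
  (b := fun i r => (Q i).[r%:R * h i]) lQ2) _.
apply: eqO_trans (bpoly_weighted h_gt0 h_le1 2 N (tail_weight N w) Q0) _.
apply: (eqO_trans (b := fun i => (Q i).[0%:R * h i] - 2^-1 * (h i * (Q i)`_1))).
  apply: eqO_eq => i; rewrite !big_ord_recl big_ord0 /= mul0r horner_coef0.
  under eq_bigr do rewrite expr0 mulr1.
  under [X in _ + (X * _ + _)]eq_bigr do rewrite expr1.
  by rewrite tail_weight_moments.1 tail_weight_moments.2; ring.
apply: eqO_sym; apply: eqO_add; first exact: (lQ2 0%N).
apply: eqO_opp; apply: eqO_mull; first exact: bigO_cst.
apply: (@bigO_weaken _ _ _ h_gt0 h_le1 2 N.+1); first by rewrite ltnW.
by apply: bigO_ext (bigO_mul (bigO_step h_gt0) DQ) => i; rewrite mulrBr.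
Qed.

(** The two sides agree on the terms of degree 0, 1 and 2 in the expansion of
    the positions: the mean of the two slopes is centred at the half step. *)
Lemma slope_mean j :
  eqO h 2 (fun i => slope N w (h i) (y i) j 0 + slope N w (h i) (shifted i) j 0)
    (fun i => 2 * v i 0%N j 0).
Proof.
have w0 := w_moments (leq0n N).
have w1 := w_moments N_gt0.
have w2 := w_moments N_gt1.
have [Q Q0 yQ] := expands_poly (yX 3 j).
pose node i r := (Q i).[r%:R * h i].
have E1 : eqO h 3 (fun i => \sum_(r < N.+1) w r * y i r j 0) (fun i => h i * (Q i)`_1).
  apply: eqO_trans (eqO_weighted (n := N.+1) w
    (a := fun i r => y i r j 0) (b := node) yQ) _.
  apply: eqO_trans (bpoly_weighted h_gt0 h_le1 3 N.+1 w Q0) _.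
  apply: eqO_eq => i.
  under eq_bigr => k _ do rewrite (w_moments (leq_trans (ltn_ord k : k <= 2)%N N_gt1)).
  by rewrite !big_ord_recl big_ord0 /= -?[bump 0 0]/1%N -?[bump 0 1]/2%N; ring.
pose w' r := if r is r'.+1 then w r' else 0.
have sw' (f : nat -> R) : \sum_(r < N.+2) w' r * f r = \sum_(r < N.+1) w r * f r.+1.
  by rewrite big_ord_recl/= mul0r add0r.
have E2 : eqO h 3 (fun i => \sum_(r < N.+1) w r * y i r.+1 j 0)
    (fun i => h i * (Q i)`_1 + 2 * (h i ^+ 2 * (Q i)`_2)).
  apply: (eqO_trans (b := fun i => \sum_(r < N.+2) w' r * y i r j 0)).
    by apply: eqO_eq => i; rewrite (sw' (fun r => y i r j 0)).
  apply: eqO_trans (eqO_weighted (n := N.+2) w'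
    (a := fun i r => y i r j 0) (b := node) yQ) _.
  apply: eqO_trans (bpoly_weighted h_gt0 h_le1 3 N.+2 w' Q0) _.
  have mom k : (k < 3)%N -> \sum_(r < N.+2) w' r * r%:R ^+ k = k%:R.
    rewrite (sw' (fun r => r%:R ^+ k)); case: k => [|[|[|//]]] _.
    - by rewrite -[RHS]w0; apply: eq_bigr => r _; rewrite !expr0.
    - rewrite -[RHS]addr0 -[X in X + _]w1 -[X in _ + X]w0 -big_split/=.
      by apply: eq_bigr => r _; rewrite -natr1; ring.
    - transitivity ((\sum_(r < N.+1) w r * r%:R ^+ 2 +
          \sum_(r < N.+1) w r * r%:R ^+ 0) +
          2 * \sum_(r < N.+1) w r * r%:R ^+ 1); last by rewrite w0 w1 w2 /=; ring.
      rewrite mulr_sumr -!big_split/=.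
      by apply: eq_bigr => r _; rewrite -natr1; ring.
  apply: eqO_eq => i; under eq_bigr => k _ do rewrite mom//.
  by rewrite !big_ord_recl big_ord0 /= -?[bump 0 0]/1%N -?[bump 0 1]/2%N; ring.
have E3 : eqO h 3 (fun i => 2 * (y i 1%N j 0 - y i 0%N j 0))
    (fun i => 2 * (h i * (Q i)`_1 + h i ^+ 2 * (Q i)`_2)).
  apply: eqO_mull; first exact: bigO_cst.
  pose c r : R := if r is 0%N then -1 else 1.
  apply: (eqO_trans (b := fun i => \sum_(r < 2) c r * y i r j 0)).
    by apply: eqO_eq => i; rewrite !big_ord_recl big_ord0 /=; ring.
  apply: eqO_trans (eqO_weighted (n := 2) c (a := fun i r => y i r j 0) (b := node) yQ) _.
  apply: eqO_trans (bpoly_weighted h_gt0 h_le1 3 2 c Q0) _.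
  apply: eqO_eq => i; rewrite !big_ord_recl !big_ord0 /=.
  by rewrite -?[bump 0 0]/1%N -?[bump 0 1]/2%N; ring.
apply: bigO_ext (bigO_div h_gt0 (eqO_add (eqO_add E1 E2) (eqO_opp E3))) => i.
rewrite !mxE /grid_deriv; have := lt0r_neq0 (h_gt0 i).
by move=> hn; field.
Qed.

(** Eliminating the grid derivative of the Lagrangian by Noether's identity
    leaves the average of the momentum terms at the two ends of the first
    interval. This average is symmetric about the half step, so the errors of
    order h cancel. *)
Lemma modified_energy_value :
  eqO h 2 (fun i => modified_energy B0 A F U N w (h i) (y i))
    (fun i => 2^-1 * dot (v i 0%N) (v i 0%N) + U (mid (y i) 0)).
Proof.
pose a i := slope N w (h i) (y i).
pose a' i := slope N w (h i) (shifted i).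
pose P i := mean_momentum B0 A (h i) (y i) 0.
pose imp i := half_impulse A F (h i) (y i) 0.
pose l i := lagrangian B0 A U (h i) (y i) 0.
have PB j : bigO h 0 (fun i => P i j 0).
  apply: (@bigO_ext _ _ _ _ _ (fun i =>
      \sum_(k < 3) W i j k * v i 0%N k 0 + A (mid (y i) 0) j 0)).
    by move=> i; rewrite [LHS]mxE; congr (_ + _); rewrite [LHS]mxE.
  apply: bigO_add; first exact: (expands_bounded h_gt0 h_le1 0 (WvX 0 j)).
  exact: (expands_bounded h_gt0 h_le1 0 (AX 0 j)).
apply: (eqO_trans (b := fun i => 2^-1 * dot (P i) (a i + a' i)
    + 2^-1 * dot (imp i) (a' i - a i) - l i)).
  apply: (eqO_trans (b := fun i => dot (left_momentum B0 A F (h i) (y i) 0) (a i)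
      - (l i - 2^-1 * (dot (right_momentum B0 A F (h i) (y i) 0) (a' i)
                       - dot (left_momentum B0 A F (h i) (y i) 0) (a i))))).
    apply: eqO_add; first exact: eqO_refl.
    apply: eqO_opp; apply: eqO_trans lagrangian_tail _.
    apply: eqO_add; first exact: eqO_refl.
    apply: eqO_opp; apply: eqO_mull; first exact: bigO_cst.
    apply: (@bigO_weaken _ _ _ h_gt0 h_le1 2 N.+1); first by rewrite ltnW.
    apply: bigO_ext (bigO_mul (bigO_step h_gt0) lagrangian_deriv) => i.
    by rewrite mulrBr; congr (_ - _); rewrite mulVKf// gt_eqF.
  apply: eqO_eq => i; rewrite /left_momentum /right_momentum dotBl dotDl.
  rewrite -/(P i) -/(imp i).
  rewrite [dot _ (a i + a' i)]dotC dotDl [dot _ (a' i - a i)]dotC dotBl.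
  rewrite ![dot _ (P i)]dotC ![dot _ (imp i)]dotC.
  by field.
apply: (eqO_trans (b := fun i => dot (P i) (v i 0%N) + 0 - l i)).
  apply: eqO_add; last exact: eqO_refl.
  apply: eqO_add.
    apply: (eqO_trans (b := fun i => 2^-1 * \sum_(j < 3) P i j 0 * (2 * v i 0%N j 0))).
      apply: eqO_mull; first exact: bigO_cst.
      apply: eqO_sum => j _; apply: eqO_mull => //.
      by apply: eqO_trans (slope_mean j); apply: eqO_eq => i; rewrite mxE.
    apply: eqO_eq => i; rewrite mulr_sumr; apply: eq_bigr => j _.
    by field.
  apply: (@bigO_ext _ _ _ _ _ (fun i => 2^-1 * dot (imp i) (a' i - a i))).
    by move=> i; rewrite subr0.
  apply: bigO_scale; apply: bigO_sum => j _.
  apply: (@bigO_mul _ _ _ 1 1).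
    apply: (@bigO_ext _ _ _ _ _ (fun i => h i * (2^-1 *
        (\sum_(k < 3) Jac A (mid (y i) 0) k j * v i 0%N k 0 + F (mid (y i) 0) j 0)))).
      move=> i; rewrite [LHS]mxE -mulrA; congr (_ * (_ * _)).
      rewrite [LHS]mxE; congr (_ + _); rewrite [LHS]mxE.
      by apply: eq_bigr => k _; congr (_ * _); rewrite [LHS]mxE.
    apply: bigO_mulr; first exact: bigO_step.
    apply: bigO_scale; apply: bigO_add; last first.
      exact: (field_bounded h (F_smooth j) (fun i => mB i 0%N)).
    apply: bigO_sum => k _; apply: bigO_mull.
      exact: (field_bounded h (Jac_smooth A_smooth k j) (fun i => mB i 0%N)).
    exact: (expands_bounded h_gt0 h_le1 0 (vX 0 k)).
  apply: (@bigO_ext _ _ _ _ _ (fun i => h i * D i (fun r => v i r j 0))).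
    move=> i; rewrite grid_deriv_velocity mulVKf ?gt_eqF//.
    by rewrite mxE; congr (_ + _); rewrite mxE.
  apply: bigO_mulr; first exact: bigO_step.
  exact: (grid_deriv_bounded h_gt0 h_le1 N_gt0 w_moments (vX _ j)).
have Wv : eqO h 2 (fun i => dot (v i 0%N) (W i *m v i 0%N))
    (fun i => dot (v i 0%N) (v i 0%N)).
  apply: eqO_sum => j _; apply: eqO_mull.
    exact: (expands_bounded h_gt0 h_le1 0 (vX 0 j)).
  apply: (@eqO_trans _ _ _ _ (fun i => \sum_(k < 3) v i 0%N k 0 * W i j k)).
    by apply: eqO_eq => i; rewrite [LHS]mxE; apply: eq_bigr => k _; rewrite mulrC.
  apply: (@eqO_trans _ _ _ _ (fun i => \sum_(k < 3) v i 0%N k 0 * (j == k)%:R)).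
    apply: eqO_sum => k _; apply: eqO_mull.
      exact: (expands_bounded h_gt0 h_le1 0 (vX 0 k)).
    exact: Psi_inv_eqO.
  apply: eqO_eq => i; rewrite (bigD1 j)//= eqxx mulr1 big1 ?addr0// => k kj.
  by rewrite eq_sym (negbTE kj) mulr0.
apply: (eqO_trans (b := fun i =>
    2^-1 * dot (v i 0%N) (W i *m v i 0%N) + U (mid (y i) 0))).
  apply: eqO_eq => i; rewrite /P /mean_momentum dotDl /l /lagrangian.
  rewrite [dot (W i *m _) _]dotC.
  by field.
by apply: eqO_add; [apply: eqO_mull => //; exact: bigO_cst|exact: eqO_refl].
Qed.

Lemma energy_value :
  eqO h 2 (fun i => energy U (mid (y i) 0) (Phi B0 (h i) *m v i 0%N))
    (fun i => 2^-1 * dot (v i 0%N) (v i 0%N) + U (mid (y i) 0)).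
Proof.
have vB k : bigO h 0 (fun i => v i 0%N k 0).
  exact: (expands_bounded h_gt0 h_le1 0 (vX 0 k)).
have Pv j : eqO h 2 (fun i => (Phi B0 (h i) *m v i 0%N) j 0) (fun i => v i 0%N j 0).
  apply: (@eqO_trans _ _ _ _ (fun i => \sum_(k < 3) v i 0%N k 0 * Phi B0 (h i) j k)).
    by apply: eqO_eq => i; rewrite [LHS]mxE; apply: eq_bigr => k _; rewrite mulrC.
  apply: (@eqO_trans _ _ _ _ (fun i => \sum_(k < 3) v i 0%N k 0 * (j == k)%:R)).
    by apply: eqO_sum => k _; apply: eqO_mull => //; exact: Phi_eqO.
  apply: eqO_eq => i; rewrite (bigD1 j)//= eqxx mulr1 big1 ?addr0// => k kj.
  by rewrite eq_sym (negbTE kj) mulr0.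
apply: eqO_add; last exact: eqO_refl.
apply: eqO_mull; first exact: bigO_cst.
apply: (@eqO_trans _ _ _ _ (fun i =>
    \sum_(j < 3) (Phi B0 (h i) *m v i 0%N) j 0 * (Phi B0 (h i) *m v i 0%N) j 0)).
  by apply: eqO_eq => i; rewrite enorm_dot.
apply: eqO_sum => j _.
have PvB := eqO_bigO (bigO_bounded h_gt0 h_le1 (Pv j)) (vB j).
apply: bigO_ext (bigO_mulr (Pv j) (bigO_add PvB (vB j))) => i.
by rewrite -!expr2 subr_sqr.
Qed.

End EnergyEstimates.
(** * Uniform constants and the long-time estimate *)

Section Uniform.
Variable R : realType.
Local Notation V := 'cV[R]_3.

Lemma uniform_bound (T : Type) (f : 'I_3 -> T -> R) :
  (forall j, exists C : R, forall i, `|f j i| <= C) ->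
  exists C : R, forall j i, `|f j i| <= C.
Proof.
move=> /choice[C fC]; exists (\sum_j `|C j|) => j i.
apply: le_trans (fC j i) _; rewrite (bigD1 j)//= (le_trans (ler_norm _))//.
by rewrite lerDl; exact: sumr_ge0.
Qed.

Lemma compact_box (K : set V) : compact K ->
  exists rho : R, forall x, K x -> box rho x.
Proof.
move=> Kc.
have [rho rhoP] : exists rho : R, forall j (x : {x | K x}), `|sval x j 0| <= rho.
  apply: uniform_bound => j.
  have [M [_ MB]] : bounded_set ((fun x : V => x j 0) @` K)%classic.
    apply: compact_bounded; apply: continuous_compact => //.
    by apply: continuous_subspaceT; exact: coord_continuous.
  exists (M + 1) => -[x Kx]; apply: (MB (M + 1)); first by rewrite ltrDl.
  by exists x.
by exists rho => x Kx j; exact: (rhoP j (exist _ x Kx)).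
Qed.

Lemma enorm_coord (u : V) j : `|u j 0| <= enorm u.
Proof.
rewrite -sqrtr_sqr ler_wsqrtr// (bigD1 j)//= lerDl.
by apply: sumr_ge0 => k _; exact: sqr_ge0.
Qed.

Lemma dot_coord (u : V) (s : R) j : dot u u <= s -> `|u j 0| <= s + 1.
Proof.
move=> us; have : u j 0 ^+ 2 <= s.
  apply: le_trans us; rewrite -enorm_dot enorm_sq (bigD1 j)//= lerDl.
  by apply: sumr_ge0 => k _; exact: sqr_ge0.
by rewrite ler_norml => u2; apply/andP; split; nra.
Qed.

Variables (B0 : V) (A F : V -> V) (U : V -> R).
Hypothesis B0_unit : enorm B0 = 1.
Hypothesis A_smooth : forall j, smooth (fun x => A x j 0).
Hypothesis F_smooth : forall j, smooth (fun x => F x j 0).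
Hypothesis U_smooth : smooth U.
Hypothesis F_grad : forall x, F x = - grad U x.
Variable rho : R.

Definition bounded_run (t : R) (y : nat -> V) : Prop :=
  [/\ 0 < t, t <= 1, forall r, box rho (y r) & forall r, FVI_step B0 A F t y r].

(** The starting relation gives the first velocity explicitly in terms of
    bounded quantities, because it contains the first increment only and not
    that increment divided by t. *)
Lemma start_velocity (Chat : R) : exists C : R, forall t y v0,
  bounded_run t y -> enorm v0 <= Chat -> FVI_start B0 A F t v0 y ->
  forall j, `|velocity t y 0 j 0| <= C.
Proof.
pose T := {p : R * (nat -> V) * V | [/\ bounded_run p.1.1 p.1.2,
  enorm p.2 <= Chat & FVI_start B0 A F p.1.1 p.2 p.1.2]}.
pose h (i : T) := (sval i).1.1; pose y (i : T) := (sval i).1.2.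
pose v0 (i : T) := (sval i).2.
have h_gt0 i : 0 < h i by case: (svalP i) => -[].
have h_le1 i : h i <= 1 by case: (svalP i) => -[].
have y_box i r : box rho (y i r) by case: (svalP i) => -[_ _ yB _] _ _; exact: yB.
have mB i : box rho (mid (y i) 0) by exact: (mid_box y_box).
suff vO j : bigO h 0 (fun i => velocity (h i) (y i) 0 j 0).
  have [j|C CB] := @uniform_bound T (fun j i => velocity (h i) (y i) 0 j 0).
    by have [C CB] := vO j; exists C => i; have := CB i; rewrite expr0 mulr1.
  by exists C => t y' v' yr vC ys j; exact: (CB j (exist _ (t, y', v') (And3 yr vC ys))).
apply: (@bigO_ext _ _ _ _ _ (fun i => \sum_(k < 3) Psi B0 (h i) j k *
   (v0 i k 0 + A (y i 0%N) k 0
    + 2^-1 * \sum_(l < 3) Jac A (mid (y i) 0) l k * (y i 1%N l 0 - y i 0%N l 0)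
    - A (mid (y i) 0) k 0 + h i / 2 * F (mid (y i) 0) k 0))).
  move=> i; have [_ _ /colP/(_ j)] := svalP i.
  rewrite -/(h i) -/(y i) -/(v0 i) => E.
  have -> : velocity (h i) (y i) 0 j 0 = (h i)^-1 * (y i 1%N j 0 - y i 0%N j 0).
    by rewrite !mxE.
  rewrite E mxE addrAC subrr add0r mxE mulKf ?gt_eqF// mxE.
  apply: eq_bigr => k _; congr (_ * _).
  have addE (a b : V) : (a + b) k 0 = a k 0 + b k 0 by rewrite mxE.
  have oppE l (a : V) : (- a) l 0 = - a l 0 by rewrite mxE.
  have scaleE (c : R) (a : V) : (c *: a) k 0 = c * a k 0 by rewrite mxE.
  rewrite !addE oppE !scaleE; congr (_ + _ * _ - _ + _).
  rewrite mxE; apply: eq_bigr => l _; congr (_ * _); first by rewrite mxE.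
  by rewrite mxE oppE.
apply: bigO_sum => k _; apply: bigO_mull; first exact: Psi_bounded.
have AO x : (forall i, box rho (x i)) -> bigO h 0 (fun i => A (x i) k 0).
  exact: (field_bounded h (A_smooth k)).
apply: bigO_add; first apply: bigO_sub; first apply: bigO_add; first apply: bigO_add.
- exists Chat => i; rewrite expr0 mulr1; have [_ + _] := svalP i.
  by apply: le_trans; exact: enorm_coord.
- by apply: AO => i; exact: y_box.
- apply: bigO_scale; apply: bigO_sum => l _; apply: bigO_mull.
    exact: (field_bounded h (Jac_smooth A_smooth l k) mB).
  by apply: bigO_sub; exists rho => i; rewrite expr0 mulr1; exact: y_box.
- exact: AO.
- apply: bigO_mull; last exact: (field_bounded h (F_smooth k) mB).
  by apply: bigO_mulr; [exact: bigO_bounded_step|exact: bigO_cst].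
Qed.

Lemma velocity_growth : exists C : R, forall t y, bounded_run t y ->
  forall j, `|velocity t y 1 j 0 - velocity t y 0 j 0| <= C.
Proof.
pose T := {p : R * (nat -> V) | bounded_run p.1 p.2}.
pose h (i : T) := (sval i).1; pose y (i : T) := (sval i).2.
have h_gt0 i : 0 < h i by case: (svalP i).
have h_le1 i : h i <= 1 by case: (svalP i).
have y_box i r : box rho (y i r) by case: (svalP i) => _ _ yB _; exact: yB.
have y_step i r : FVI_step B0 A F (h i) (y i) r by case: (svalP i).
have vO := velocity_increment_bounded h_gt0 h_le1 A_smooth F_smooth y_box y_step 0.
have [j|C CB] := @uniform_bound T
    (fun j i => velocity (h i) (y i) 1 j 0 - velocity (h i) (y i) 0 j 0).
  by have [C CB] := vO j; exists C => i; have := CB i; rewrite expr0 mulr1.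
by exists C => t y' yr j; exact: (CB j (exist _ (t, y') yr)).
Qed.

Definition leading_energy (t : R) (y : nat -> V) : R :=
  2^-1 * dot (velocity t y 0) (velocity t y 0) + U (mid y 0).

(** The preceding estimates with the runs of bounded initial velocity as the
    index set. *)
Lemma energy_estimates (N : nat) (w : nat -> R) (vmax : R) : (1 < N)%N ->
  (forall k, (k <= N)%N -> \sum_(r < N.+1) w r * r%:R ^+ k = (k == 1)%:R) ->
  exists2 C : R, 0 < C & forall t y, bounded_run t y ->
    (forall j, `|velocity t y 0 j 0| <= vmax) ->
    [/\ `|modified_energy B0 A F U N w t (fun r => y r.+1)
          - modified_energy B0 A F U N w t y| <= C * t ^+ N.+1,
        `|modified_energy B0 A F U N w t y - leading_energy t y| <= C * t ^+ 2 &
        `|energy U (mid y 0) (Phi B0 t *m velocity t y 0) - leading_energy t y|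
          <= C * t ^+ 2].
Proof.
move=> N1 wm.
pose T := {p : R * (nat -> V) | bounded_run p.1 p.2 /\
  forall j, `|velocity p.1 p.2 0 j 0| <= vmax}.
pose h (i : T) := (sval i).1; pose y (i : T) := (sval i).2.
have h_gt0 i : 0 < h i by case: (svalP i) => -[].
have h_le1 i : h i <= 1 by case: (svalP i) => -[].
have y_box i r : box rho (y i r) by case: (svalP i) => -[_ _ yB _] _; exact: yB.
have y_step i r : FVI_step B0 A F (h i) (y i) r by case: (svalP i) => -[].
have v0B j : bigO h 0 (fun i => velocity (h i) (y i) 0 j 0).
  by exists vmax => i; rewrite expr0 mulr1; case: (svalP i).
have [C1 H1] := modified_energy_drift h_gt0 h_le1 B0_unit A_smooth F_smooth
  U_smooth F_grad y_box y_step v0B N1 wm.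
have [C2 H2] := modified_energy_value h_gt0 h_le1 B0_unit A_smooth F_smooth
  U_smooth F_grad y_box y_step v0B N1 wm.
have [C3 H3] := energy_value h_gt0 h_le1 U A_smooth F_smooth y_box y_step v0B.
exists (`|C1| + `|C2| + `|C3| + 1); first by rewrite ltr_wpDl.
move=> t y' yr yv; have t0 : 0 < t by case: yr.
pose i : T := exist _ (t, y') (conj yr yv).
have weak c k : c <= `|C1| + `|C2| + `|C3| + 1 ->
    c * t ^+ k <= (`|C1| + `|C2| + `|C3| + 1) * t ^+ k.
  by apply: ler_wpM2r; rewrite exprn_ge0// ltW.
have := ler_norm C1; have := ler_norm C2; have := ler_norm C3.
have := normr_ge0 C1; have := normr_ge0 C2; have := normr_ge0 C3.
move=> p3 p2 p1 n3 n2 n1.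
split.
- by apply: le_trans (H1 i) (weak _ _ _); lra.
- by apply: le_trans (H2 i) (weak _ _ _); lra.
- by apply: le_trans (H3 i) (weak _ _ _); lra.
Qed.

End Uniform.
(** The bootstrap in the number of steps: conservation of the modified energy
    keeps the velocities bounded, and bounded velocities give the estimates
    under which the modified energy is conserved for one more step. *)
Lemma energy_drift (R : realType) (B0 : 'cV[R]_3) (A F : 'cV[R]_3 -> 'cV[R]_3)
    (U : 'cV[R]_3 -> R) (rho Chat : R) N :
  enorm B0 = 1 -> (forall j, smooth (fun x => A x j 0)) ->
  (forall j, smooth (fun x => F x j 0)) -> smooth U ->
  (forall x, F x = - grad U x) -> (1 < N)%N ->
  exists h0 C : R, [/\ 0 < h0, h0 <= 1, 0 < C &
    forall t (x : nat -> 'cV[R]_3) v0,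
      bounded_run B0 A F rho t x -> enorm v0 <= Chat -> FVI_start B0 A F t v0 x ->
      t <= h0 -> forall n, n%:R * t ^+ N.-1 <= 1 ->
      `|energy U (mid x n) (Phi B0 t *m velocity t x n)
        - energy U (mid x 0) (Phi B0 t *m velocity t x 0)| <= C * t ^+ 2].
Proof.
move=> B1 AC FC UC FU N1.
have [w wm] := derivative_weights R N.
have [V1 V1P] := start_velocity B0 AC FC rho Chat.
have [V2 V2P] := velocity_growth B0 AC FC rho.
have [M MP] := continuous_box rho (UC 0%N).
pose e := 2^-1 * (3 * V1 ^+ 2) + M.
(* The energy level e + 1 bounds the velocity of one step, and the last term
   leaves room for the growth in the next step. *)
pose vmax := 2 * (e + 1 + M) + 1 + `|V2|.
have [C C0 CP] := energy_estimates B1 AC FC UC FU rho vmax N1 wm.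
(* For t <= h0 the three energy errors of one comparison add up to at most 1. *)
pose h0 : R := (1 + 3 * C)^-1.
have D0 : 0 < 1 + 3 * C by rewrite addr_gt0// mulr_gt0.
exists h0, (5 * C); split.
- by rewrite invr_gt0.
- by rewrite invf_le1// lerDl mulr_ge0// ltW.
- by rewrite mulr_gt0.
move=> t x v0 xr vC xs th n nN.
have [t0 t1 xB xS] := xr.
(* Every estimate concerns the first steps of a run, so it is applied to the
   run restarted at the n-th node. *)
pose win n r := x (r + n)%N.
have winr k : bounded_run B0 A F rho t (win k).
  by split=> // r; [exact: xB|exact: xS].
have winS k : (fun r => win k r.+1) = win k.+1.
  by apply/funext => r; rewrite /win addSnnS.
pose E k := modified_energy B0 A F U N w t (win k).
pose L k := leading_energy U t (win k).
have UM k : `|U (mid x k)| <= M by apply: MP; exact: (mid_box (fun=> xB) tt k).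
have Lv k : L k <= e + 1 -> forall j, `|velocity t x k j 0| <= 2 * (e + 1 + M) + 1.
  move=> Lk j; apply: dot_coord.
  have := UM k; rewrite ler_norml => /andP[UM1 _].
  by move: Lk; rewrite /L /leading_energy -[mid (win k) 0]/(mid x k)
    -[velocity t (win k) 0]/(velocity t x k); lra.
have vle k : L k <= e + 1 -> forall j, `|velocity t (win k) 0 j 0| <= vmax.
  by move=> /Lv Lk j; apply: le_trans (Lk j) _; rewrite lerDl.
have vnext k : L k <= e + 1 -> forall j, `|velocity t (win k.+1) 0 j 0| <= vmax.
  move=> /Lv Lk j; have := V2P t (win k) (winr k) j.
  rewrite -[velocity t (win k) 1]/(velocity t x k.+1).
  rewrite -[velocity t (win k) 0]/(velocity t x k) => V2k.
  rewrite -[velocity t (win k.+1) 0]/(velocity t x k.+1).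
  rewrite -[velocity _ _ _ _ _](subrK (velocity t x k j 0)) addrC.
  apply: le_trans (ler_normD _ _) _; apply: lerD => //.
  by apply: le_trans V2k _; exact: ler_norm.
have small : 3 * (C * t ^+ 2) <= 1.
  have : (1 + 3 * C) * t <= 1 by rewrite -ler_pdivlMl// mulr1.
  have : t ^+ 2 <= t by rewrite expr2 ler_piMr// ltW.
  by move: C0 t0; move: (t ^+ 2) => u; nra.
have L0 : L 0%N <= e.
  rewrite /L /leading_energy /e; apply: lerD; last first.
    by apply: le_trans (UM 0%N); exact: ler_norm.
  rewrite ler_pM2l ?invr_gt0// /dot.
  have V1v j : velocity t x 0 j 0 * velocity t x 0 j 0 <= V1 ^+ 2.
    have := V1P t x v0 xr vC xs j.
    by rewrite ler_norml => /andP[a b]; nra.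
  apply: le_trans (ler_sum _ (fun j _ => V1v j)) _.
  by rewrite sumr_const card_ord mulr_natl.
have steps k : (k <= n)%N -> k%:R * (C * t ^+ N.+1) <= C * t ^+ 2.
  move=> kn; have -> : N.+1 = (N.-1 + 2)%N by rewrite addn2 prednK// ltnW.
  rewrite exprD mulrCA ler_pM2l// mulrA ler_piMl ?exprn_ge0 ?(ltW t0)//.
  apply: le_trans nN; rewrite ler_wpM2r ?exprn_ge0 ?(ltW t0)//.
  by rewrite ler_nat.
have EL k : L k <= e + 1 -> `|E k - L k| <= C * t ^+ 2.
  by move=> Lk; have [_ + _] := CP t (win k) (winr k) (vle k Lk).
have L0' : L 0%N <= e + 1 by rewrite (le_trans L0)// lerDl.
have main k : (k <= n)%N ->
    L k <= e + 1 /\ `|E k - E 0%N| <= k%:R * (C * t ^+ N.+1).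
  elim: k => [|k IHk] kn; first by rewrite subrr normr0 mul0r.
  have [Lk Ek] := IHk (ltnW kn).
  have [drift _ _] := CP t (win k) (winr k) (vle k Lk).
  have [_ EL1 _] := CP t (win k.+1) (winr k.+1) (vnext k Lk).
  rewrite winS -/(E k.+1) -/(E k) in drift.
  have Ek1 : `|E k.+1 - E 0%N| <= k.+1%:R * (C * t ^+ N.+1).
    rewrite -[E k.+1](subrK (E k)) -addrA -natr1 addrC [_ + 1]addrC mulrDl mul1r.
    rewrite addrC; apply: le_trans (ler_normD _ _) _; exact: lerD.
  split=> //; have := EL _ L0'; have := steps _ kn.
  move: Ek1 EL1; rewrite -/(E k.+1) -/(L k.+1) => Ek1 EL1 sk EL0.
  move: (le_trans Ek1 sk) EL1 EL0; rewrite !ler_norml.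
  move=> /andP[_ a] /andP[b _] /andP[_ c].
  by move: small L0; lra.
have [Ln En] := main n (leqnn n).
have [_ _ Hn] := CP t (win n) (winr n) (vle n Ln).
have [_ _ H0] := CP t (win 0%N) (winr 0%N) (vle 0%N L0').
have ELn := EL n Ln; have EL0 := EL 0%N L0'.
have := le_trans En (steps n (leqnn n)).
move: Hn H0 ELn EL0; rewrite -/(L n) -/(L 0%N).
rewrite -[mid (win n) 0]/(mid x n) -[velocity t (win n) 0]/(velocity t x n).
rewrite -[mid (win 0%N) 0]/(mid x 0) -[velocity t (win 0%N) 0]/(velocity t x 0).
rewrite !ler_norml.
move=> /andP[a1 b1] /andP[a2 b2] /andP[a3 b3] /andP[a4 b4] /andP[a5 b5].
by apply/andP; split; lra.
Qed.

Theorem theorem3p2 (R : realType)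
    (B0 : 'cV[R]_3) (B1 A1 F : 'cV[R]_3 -> 'cV[R]_3) (U : 'cV[R]_3 -> R)
    (Chat : R) (K : set 'cV[R]_3) (N : nat)
    (hB0 : enorm B0 = 1)
    (hA1 : smooth A1) (hB1A1 : forall x, B1 x = curl A1 x)
    (hB1s : smooth B1) (hB1b : bounded_field B1)
    (hB1nc : ~ exists b, forall x, B1 x = b)
    (hU : forall x, differentiable U x) (hFU : forall x, F x = - grad U x)
    (hFs : smooth F) (hFb : bounded_field F)
    (hK : compact K)
    (hN : (3 <= N)%N) :
  exists c C : R, 0 < c /\ 0 < C /\
    forall (h : R) (x0 v0 : 'cV[R]_3) (x v : nat -> 'cV[R]_3),
      0 < h ->
      enorm x0 <= Chat -> enorm v0 <= Chat ->
      FVI B0 (full_potential B0 A1) F h x0 v0 x v ->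
      (forall n, K (x n)) ->
      forall n : nat, n%:R * h <= c * h ^ (- N%:Z + 2) ->
        `| energy U (mid x n) (mid v n) - energy U (mid x 0) (mid v 0) |
          <= C * h ^+ 2.
Proof.
have AC j : smooth (fun x => full_potential B0 A1 x j 0).
  exact: smooth_full_potential.
have FC j : smooth (fun x => F x j 0) by exact: smooth_component.
have UC : smooth U by exact: (smooth_of_grad hU hFU hFs).
have [rho rhoP] := compact_box hK.
have [h0 [C [h00 h01 C0 CP]]] :=
  energy_drift rho Chat hB0 AC FC UC hFU (ltnW hN).
(* With this c, the time restriction forces h <= h0 as soon as one step is
   made, and bounds the number of steps by h^(1 - N). *)
exists (h0 ^+ N.-1), C; split; first by rewrite exprn_gt0.
split=> // h x0 v0 x v hgt0 x0C v0C [xx0 vv0 xs xS vS] xK n nh.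
have -> : mid v n = Phi B0 h *m velocity h x n by exact: vS.
have -> : mid v 0 = Phi B0 h *m velocity h x 0 by exact: vS.
case: n nh => [|n] nh.
  by rewrite subrr normr0 mulr_ge0 ?exprn_ge0 ?(ltW C0) ?(ltW hgt0).
have nhN : n.+1%:R * h ^+ N.-1 <= h0 ^+ N.-1.
  case: N hN nh {C0 CP h00 h01} => [|[|N]]// _.
  have -> : - (N.+2)%:Z + 2 = - N%:Z :> int by lia.
  rewrite -exprnN ler_pdivlMr ?exprn_gt0//.
  by rewrite -mulrA -exprS.
have hh0 : h <= h0.
  rewrite leNgt; apply/negP => h0h.
  have N1 : (0 < N.-1)%N by rewrite -ltnS prednK ltnW// ltnW.
  have : h0 ^+ N.-1 < h ^+ N.-1 by rewrite ltr_pXn2r// nnegrE ltW.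
  rewrite ltNge => /negP; apply; apply: le_trans nhN.
  by rewrite ler_peMl ?exprn_ge0 ?ler1n// ltW.
have run : bounded_run B0 (full_potential B0 A1) F rho h x.
  by split=> //; [exact: le_trans hh0 h01|move=> r; exact: rhoP].
apply: (CP h x v0) => //.
by apply: le_trans nhN _; rewrite exprn_ile1// ltW.
Qed.
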